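(* Let $R=k[x_1,\ldots,x_n]$ be a polynomial ring over a field $k$ with homogeneous maximal ideal $\mathfrak m$, let $2\le r\le n$, and let $f_1,\ldots,f_r$ be a homogeneous regular sequence in $R$ of degrees $d_1\ge\cdots\ge d_r$. Let $d\ge d_1+d_2$ be an integer, put $a_i=d-d_i$, $M=\mathfrak m^{a_1}\oplus\cdots\oplus\mathfrak m^{a_r}$, and let $I=(f_1,\ldots,f_r)_{\ge d}=\mathfrak m^{a_1}f_1+\cdots+\mathfrak m^{a_r}f_r$. Then $$\mathcal R(I)=\mathcal R(M)/(h_1,\ldots,h_t)\mathcal R(M)=S/(I_2(C),h_1,\ldots,h_t),$$ i.e. the kernel of the epimorphism $\chi:S\to\mathcal R(I)$ given in the context is the ideal $I_2(C)+(h_1,\ldots,h_t)$.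
   Context: For an integer $a\ge 1$ let $\mathcal J_a$ be the set of multi-indices $\underline j=(j_{n-1},\ldots,j_1)$ of integers with $0\le j_1\le\cdots\le j_{n-1}\le a$, and let $\mathcal J'_a$ be the subset of those with $1\le j_1$. For $\underline j\in\mathcal J_a$ put $\underline x^{a,\underline j}=\prod_{i=1}^n x_i^{j_i-j_{i-1}}$, where $j_0=0$, $j_n=a$ (these are the monomials of degree $a$). The $a_i$ here satisfy $1\le a_1\le\cdots\le a_r$. $\mathcal R(M)=R[\{\underline x^{a_l,\underline j}t_l : 1\le l\le r,\ \underline j\in\mathcal J_{a_l}\}]\subset R[t_1,\ldots,t_r]$ is the Rees algebra of $M$, and $\mathcal R(I)=R[It]\subset R[t]$ is the Rees algebra of $I$. Let $T=k[T_{l,\underline j} : 1\le l\le r,\ \underline j\in\mathcal J_{a_l}]$ and $S=T[x_1,\ldots,x_n]$ be polynomial rings. Let $\phi:S\to\mathcal R(M)$ be the $R$-algebra epimorphism with $\phi(T_{l,\underline j})=\underline x^{a_l,\underline j}t_l$, let $\Psi:\mathcal R(M)\to\mathcal R(I)$ be the natural $R$-algebra epimorphism with $\Psi(ut_l)=uf_lt$ for $u\in\mathfrak m^{a_l}$, and let $\chi=\Psi\circ\phi$. For $\underline j\in\mathcal J'_{a_l}$ and $1\le s\le n$ let $T_{l,\underline j,s}$ denote the variable $T_{l,(j_{n-1},\ldots,j_s,\,j_{s-1}-1,\ldots,j_1-1)}$. Let $B$ be the matrix with $n$ rows, with columns indexed by the pairs $(l,\underline j)$, $1\le l\le r$, $\underline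 j\in\mathcal J'_{a_l}$, ordered lexicographically, whose entry in row $s$ and column $(l,\underline j)$ is $T_{l,\underline j,s}$; let $C$ be obtained from $B$ by adjoining as first column $(x_1,\ldots,x_n)^{\rm tr}$. $I_2(C)$ is the $S$-ideal generated by the $2\times2$ minors of $C$. The polynomials $h_1,\ldots,h_t\in T\subset S$ are the following linear forms. For each pair $1\le i<j\le r$ and each monomial $m$ in $R$ of degree $d-d_i-d_j\ge 0$, write $mf_j=\sum_{\underline k\in\mathcal J_{a_i}}c_{\underline k}\,\underline x^{a_i,\underline k}$ and $mf_i=\sum_{\underline k\in\mathcal J_{a_j}}b_{\underline k}\,\underline x^{a_j,\underline k}$ with $c_{\underline k},b_{\underline k}\in k$; the corresponding linear form is $-\sum_{\underline k\in\mathcal J_{a_i}}c_{\underline k}T_{i,\underline k}+\sum_{\underline k\in\mathcal J_{a_j}}b_{\underline k}T_{j,\underline k}$. Listing all of them gives $h_1,\ldots,h_t$ with $t=\sum_{1\le i<j\le r}\binom{d-d_i-d_j+n-1}{n-1}$. *)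

(* Defs.v *)
From mathcomp Require Import all_boot all_order all_algebra.
From mathcomp Require Export mpoly.

Set Implicit Arguments.
Unset Strict Implicit.
Unset Printing Implicit Defensive.

Import GRing.Theory.
Local Open Scope ring_scope.

Section GeneralAlgebra.
Variable A : comNzRingType.

(* The B-span of G, for a subring B of A. If G is included in B, this is the
   ideal of B generated by G. *)
Definition ideal_in (B G : A -> Prop) (x : A) : Prop :=
  exists (m : nat) (c g : 'I_m -> A),
    (forall i, B (c i) /\ G (g i)) /\ x = \sum_(i < m) c i * g i.

Definition ideal (G : A -> Prop) : A -> Prop := ideal_in (fun _ => True) G.

Definition ideal_exp (J : A -> Prop) (a : nat) : A -> Prop :=
  ideal (fun x => exists2 u : 'I_a -> A, (forall i, J (u i)) & x = \prod_i u i).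

Definition regular_sequence (r : nat) (f : 'I_r -> A) : Prop :=
  (forall (i : 'I_r) (g : A),
     ideal (fun u => exists2 j : 'I_r, (j < i)%N & u = f j) (f i * g) ->
     ideal (fun u => exists2 j : 'I_r, (j < i)%N & u = f j) g)
  /\ ~ ideal (fun u => exists j : 'I_r, u = f j) 1.

Definition minor2 (m p : nat) (C : 'M[A]_(m, p)) (x : A) : Prop :=
  exists (s : 'I_2 -> 'I_m) (c : 'I_2 -> 'I_p),
    [/\ {homo s : i j / (i < j)%N}, {homo c : i j / (i < j)%N}
      & x = \det (mxsub s c C)].

Definition I2 (m p : nat) (C : 'M[A]_(m, p)) : A -> Prop := ideal (minor2 C).

Inductive subalg (E : algType A) (G : E -> Prop) : E -> Prop :=
| subalg_scalar (c : A) : subalg G c%:A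
| subalg_gen x : G x -> subalg G x
| subalg_add x y : subalg G x -> subalg G y -> subalg G (x + y)
| subalg_mul x y : subalg G x -> subalg G y -> subalg G (x * y).

End GeneralAlgebra.

(* f maps the subring DA of A onto the subring DB of B, and the kernel of this
   surjection is the ideal K of DA: this is DB = DA / K. *)
Definition is_quotient_via (A B : nzRingType) (f : {rmorphism A -> B})
    (DA : A -> Prop) (DB : B -> Prop) (K : A -> Prop) : Prop :=
  (forall b, DB b <-> exists2 a, DA a & f a = b)
  /\ (forall a, DA a -> (f a = 0 <-> K a)).

(* The tuple lists (j_1, ..., j_{n-1}) in increasing order of the subscripts. *)
Definition J (n a : nat) : Type :=
  {j : n.-1.-tuple 'I_a.+1 | sorted leq [seq val i | i <- j]}.

(* j_i for 0 <= i <= n, including j_0 = 0 and j_n = a; the latter is the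
   default value of nth. *)
Definition jent (n a : nat) (j : J n a) (i : nat) : nat :=
  nth a (0%N :: [seq val i | i <- val j]) i.

(* The ordinal i : 'I_n stands for the subscript i + 1, in x_1, ..., x_n. *)
Definition jmnm (n a : nat) (j : J n a) : 'X_{1..n} :=
  [multinom (jent j i.+1 - jent j i)%N | i < n].

Lemma jent_homo n a (j : J n a) (i1 i2 : nat) :
  (i1 <= i2)%N -> (i2 < n)%N -> (jent j i1 <= jent j i2)%N.
Proof.
move=> le12 lt2; have szj: size [seq val i | i <- val j] = n.-1.
  by rewrite size_map size_tuple.
rewrite /jent; case: i1 le12 => [|i1] //.
case: i2 lt2 => // i2 lt2 lt12 /=.
have lt2' : (i2 < n.-1)%N by case: (n) lt2.
apply: (sorted_leq_nth leq_trans leqnn _ (svalP j)) => //.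
- by rewrite inE szj (leq_ltn_trans _ lt2').
- by rewrite inE szj.
Qed.

Lemma jshift_subproof n a (j : J n a) (s : 'I_n) :
  sorted leq [seq val i | i <-
    [tuple (inord (jent j i.+1 - (i < s)) : 'I_a.+1) | i < n.-1]].
Proof.
have jent_le (i : 'I_n.-1) : (jent j i.+1 <= a)%N.
  rewrite /jent /= (nth_map ord0) ?size_tuple // -ltnS; exact: ltn_ord.
apply: (@path_sorted _ _ 0%N); apply/(pathP 0%N) => i.
rewrite size_map size_tuple => lt_i; case: i lt_i => [|i] lt_i //=.
have lt_i' : (i < n.-1)%N by apply: ltnW.
have nth_j i0 (lt0 : (i0 < n.-1)%N) :
    nth 0%N [seq val i | i <-
      [tuple (inord (jent j i.+1 - (i < s)) : 'I_a.+1) | i < n.-1]] i0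
    = (jent j i0.+1 - (i0 < s))%N.
  rewrite (nth_map ord0) ?size_tuple // -(tnth_nth ord0 _ (Ordinal lt0)).
  rewrite tnth_mktuple; apply: inordK; rewrite ltnS.
  exact: leq_trans (leq_subr _ _) (jent_le (Ordinal lt0)).
rewrite !nth_j //.
have lt2 : (i.+2 < n)%N by case: (n) lt_i.
have le_j := jent_homo j (leqnSn i.+1) lt2.
case: (ltnP i.+1 s) => [lt_s|_]; first by rewrite (ltnW lt_s) leq_sub2r.
by rewrite subn0; apply: leq_trans (leq_subr _ _) le_j.
Qed.

(* (j_{n-1}, ..., j_s, j_{s-1} - 1, ..., j_1 - 1). With a 0-based s : 'I_n,
   the decreased entries j_{i+1} are those with i < s. Only meaningful when
   1 <= j_1, because of the truncated subtraction. *)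
Definition jshift (n a : nat) (j : J n a) (s : 'I_n) : J n a :=
  Sub [tuple (inord (jent j i.+1 - (i < s)) : 'I_a.+1) | i < n.-1]
      (jshift_subproof j s).

Section ReesPresentation.
Variables (k : fieldType) (n r : nat).

Definition max_ideal : {mpoly k[n]} -> Prop :=
  ideal (fun x => exists i : 'I_n, x = 'X_i).

Section Variables.
Variable a : 'I_r -> nat.

Definition Tidx : Type := {l : 'I_r & J n (a l)}.

Local Notation Tring := {mpoly k[#|{: Tidx}|]}.
Local Notation Sring := {mpoly {mpoly k[#|{: Tidx}|]}[n]}.

Definition Tvar (l : 'I_r) (j : J n (a l)) : Tring :=
  'X_(enum_rank (Tagged (fun l => J n (a l)) j)).

(* The pairs (l, j) with j in J'_{a_l}. *)
Definition Cidx : Type := {v : Tidx | (1 <= jent (tagged v) 1)%N}.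

(* The columns follow the standard enumeration of Cidx; reordering them does
   not change the ideal of minors. *)
Definition Bmx : 'M[Tring]_(n, #|{: Cidx}|) :=
  \matrix_(s, c) let v : Tidx := val (enum_val c) in
                 @Tvar (tag v) (jshift (tagged v) s).

Definition Cmx : 'M[Sring]_(n, 1 + #|{: Cidx}|) :=
  row_mx (\col_s 'X_s) (map_mx (@mpolyC n {mpoly k[#|{: Tidx}|]}) Bmx).

(* R[t_1, ..., t_r] is {mpoly {mpoly k[n]}[r]}, and R[t] is
   {poly {mpoly k[n]}}. *)
Definition ReesM : {mpoly {mpoly k[n]}[r]} -> Prop :=
  subalg (fun p => exists (l : 'I_r) (j : J n (a l)),
                     p = ('X_[jmnm j] : {mpoly k[n]}) *: 'X_l).

Definition phiT : {rmorphism Tring -> {mpoly {mpoly k[n]}[r]}} :=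
  mmap (@mpolyC r {mpoly k[n]} \o @mpolyC n k)
    (fun v => let w := enum_val v in
              ('X_[jmnm (tagged w)] : {mpoly k[n]}) *: 'X_(tag w)).

Definition phi : {rmorphism Sring -> {mpoly {mpoly k[n]}[r]}} :=
  mmap phiT (fun i => ('X_i)%:MP).

End Variables.

Section Forms.
Variables (f : 'I_r -> {mpoly k[n]}) (e : 'I_r -> nat) (d : nat).

Definition adeg (l : 'I_r) : nat := (d - e l)%N.

Local Notation Tring := {mpoly k[#|{: Tidx adeg}|]}.
Local Notation Sring := {mpoly {mpoly k[#|{: Tidx adeg}|]}[n]}.

(* The restriction of this R-algebra map to R(M) sends u t_l to u f_l t. *)
Definition Psi : {rmorphism {mpoly {mpoly k[n]}[r]} -> {poly {mpoly k[n]}}} :=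
  mmap (@polyC {mpoly k[n]}) (fun l => f l *: 'X).

Definition chi : {rmorphism Sring -> {poly {mpoly k[n]}}} :=
  Psi \o phi adeg.

(* (f_1, ..., f_r)_{>= d}: as (f_1, ..., f_r) is homogeneous, its component in
   degrees >= d consists of its elements without terms of degree < d. *)
Definition Itrunc (g : {mpoly k[n]}) : Prop :=
  ideal (fun u => exists l : 'I_r, u = f l) g
  /\ (forall m, m \in msupp g -> (d <= mdeg m)%N).

Definition ReesI : {poly {mpoly k[n]}} -> Prop :=
  subalg (fun p => exists2 g, Itrunc g & p = g *: 'X).

Definition hform (i j : 'I_r) (m : 'X_{1..n}) : Tring :=
  - (\sum_(v : J n (adeg i)) ('X_[m] * f j)@_(jmnm v) *: Tvar v)
  + \sum_(v : J n (adeg j)) ('X_[m] * f i)@_(jmnm v) *: Tvar v.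

Definition hforms (h : Tring) : Prop :=
  exists (i j : 'I_r) (m : 'X_{1..n}),
    [/\ (i < j)%N, (mdeg m + (e i + e j) = d)%N & h = hform i j m].

End Forms.
End ReesPresentation.

(* Main.v *)
Require Import Defs.
From mathcomp Require Import all_boot all_order all_algebra.
From mathcomp Require Import mpoly.
From mathcomp Require Import ring zify.

Set Implicit Arguments.
Unset Strict Implicit.
Unset Printing Implicit Defensive.

Import GRing.Theory.
Local Open Scope ring_scope.

(* The map [chi] is the composite of [phi] and [Psi], so its kernel is obtained
   by lifting generators of the kernel of [Psi] through [phi].

   Kernel of [Psi]: a regular sequence is of linear type, i.e. the kernel of
   [R[t_1, ..., t_r] -> R[t]], [t_l |-> f_l t], is generated by the Koszul
   relations [f_i t_j - f_j t_i]. Give [t_l] the degree [- a_l]; then [R(M)] is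
   the part of nonnegative degree, the Koszul relations are homogeneous, and
   truncating the coefficients of a Koszul combination lying in [R(M)] rewrites
   it with coefficients in [R(M)] on the multiples [m (f_i t_j - f_j t_i)] with
   [deg m = d - d_i - d_j], which are the images of the forms [h].

   Kernel of [phi]: it is spanned by differences of monomials with the same
   image. Two such monomials distribute the same variables [x_i] over the same
   number of factors [T_l] (plus the free [x]-part), so they are connected by
   exchanges of two variables between two factors, and one exchange is a
   [2 x 2] minor of [C]. *)

(** * Koszul relations of a regular sequence *)

Section Ideals.
Variable A : comNzRingType.
Implicit Types (B G P : A -> Prop).

Lemma ideal_in_ind B G P : P 0 -> (forall x y, P x -> P y -> P (x + y)) ->
  (forall c g, B c -> G g -> P (c * g)) -> forall x, ideal_in B G x -> P x.
Proof.
move=> P0 PD Pg x [m [c [g [cg ->]]]].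
by apply: big_ind => // i _; have [? ?] := cg i; apply: Pg.
Qed.

Lemma ideal_in0 B G : ideal_in B G 0.
Proof. by exists 0%N, (fun=> 0), (fun=> 0); split; [case|rewrite big_ord0]. Qed.

Lemma ideal_inD B G x y : ideal_in B G x -> ideal_in B G y -> ideal_in B G (x + y).
Proof.
move=> [m [c [g [cg ->]]]] [m' [c' [g' [cg' ->]]]].
exists (m + m')%N, (fun i => match split i with inl j => c j | inr j => c' j end),
  (fun i => match split i with inl j => g j | inr j => g' j end); split.
  by move=> i; case: (split i).
rewrite big_split_ord /=; congr (_ + _); apply: eq_bigr => i _.
  by rewrite (unsplitK (inl i)).
by rewrite (unsplitK (inr i)).
Qed.

Lemma ideal_in_gen B G c g : B c -> G g -> ideal_in B G (c * g).
Proof. by move=> ? ?; exists 1%N, (fun=> c), (fun=> g); rewrite big_ord1. Qed.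

Lemma ideal_in_sum B G (I : Type) (s : seq I) (Q : pred I) (F : I -> A) :
  (forall i, Q i -> ideal_in B G (F i)) -> ideal_in B G (\sum_(i <- s | Q i) F i).
Proof. by move=> H; apply: big_ind => //; [exact: ideal_in0|exact: ideal_inD]. Qed.

Lemma ideal_gen G g : G g -> ideal G g.
Proof. by move=> Gg; rewrite -[g]mul1r; apply: ideal_in_gen. Qed.

Lemma idealM G c x : ideal G x -> ideal G (c * x).
Proof.
move: x; apply: ideal_in_ind => [|x y ? ?|b g _ Gg]; first by rewrite mulr0; apply: ideal_in0.
  by rewrite mulrDr; apply: ideal_inD.
by rewrite mulrA; apply: ideal_in_gen.
Qed.

Lemma idealB G x y : ideal G x -> ideal G y -> ideal G (x - y).
Proof. by move=> Gx Gy; rewrite -mulN1r; apply: ideal_inD => //; apply: idealM. Qed.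

Lemma ideal_sub G P x : (forall y, G y -> ideal P y) -> ideal G x -> ideal P x.
Proof.
move=> GP; move: x; apply: ideal_in_ind => [|x y ? ?|b g _ /GP Gg].
- exact: ideal_in0.
- exact: ideal_inD.
- exact: idealM.
Qed.

End Ideals.

Section Koszul.
Variables (A : comNzRingType) (r : nat) (f : 'I_r -> A).
Local Notation AT := {mpoly A[r]}.

Definition koszul_rel (a b : 'I_r) : AT := f a *: 'X_b - f b *: 'X_a.

(** Only relations among the first [i] elements are allowed, because [i] is the outer induction
    parameter of [koszul_kernel]. *)
Definition koszul (i : nat) : AT -> Prop :=
  ideal (fun p => exists a b : 'I_r, [/\ (a < b)%N, (b < i)%N & p = koszul_rel a b]).

Definition init (i : nat) : A -> Prop :=
  ideal (fun u => exists2 j : 'I_r, (j < i)%N & u = f j).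

(** Forms of degree [s] in the first [i] variables. The condition bears on the support, so 0 is a
    form of every degree. *)
Definition is_form (i s : nat) (F : AT) : Prop :=
  {in msupp F, forall m : 'X_{1..r},
     mdeg m = s /\ forall l : 'I_r, (i <= l)%N -> m l = 0%N}.

Lemma form0 i s : is_form i s 0.
Proof. by move=> m; rewrite msupp0. Qed.

Lemma formD i s F G : is_form i s F -> is_form i s G -> is_form i s (F + G).
Proof. by move=> hF hG m /msuppD_le; rewrite mem_cat => /orP[/hF|/hG]. Qed.

Lemma formZ i s c F : is_form i s F -> is_form i s (c *: F).
Proof. by move=> hF m /msuppZ_le /hF. Qed.

Lemma formN i s F : is_form i s F -> is_form i s (- F).
Proof. by rewrite -scaleN1r; apply: formZ. Qed.

Lemma form_sum i s (I : Type) (t : seq I) (Q : pred I) (F : I -> AT) :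
  (forall j, Q j -> is_form i s (F j)) -> is_form i s (\sum_(j <- t | Q j) F j).
Proof. by move=> H; apply: big_ind => //; [exact: form0|exact: formD]. Qed.

Lemma formX i s (m : 'X_{1..r}) :
  mdeg m = s -> (forall l : 'I_r, (i <= l)%N -> m l = 0%N) -> is_form i s 'X_[m].
Proof. by move=> ? ? m'; rewrite msuppX inE => /eqP->. Qed.

Lemma form_mulX i s F (l : 'I_r) : (l < i)%N -> is_form i s F -> is_form i s.+1 ('X_l * F).
Proof.
move=> li hF m; rewrite mulrC (perm_mem (msuppMX _ _)) => /mapP[m' /hF[degm m0] ->].
rewrite mdegD mdeg1 degm; split=> // j ij.
rewrite mnmDE mnm1E m0 //; case: eqP => // lj.
by rewrite lj ltnNge ij in li.
Qed.

Lemma formW i j s F : (i <= j)%N -> is_form i s F -> is_form j s F.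
Proof. by move=> ij hF m /hF[-> h]; split=> // l jl; apply/h/(leq_trans ij). Qed.

Lemma form_ind i s (P : AT -> Prop) : P 0 -> (forall F G, P F -> P G -> P (F + G)) ->
  (forall (c : A) (m : 'X_{1..r}), mdeg m = s ->
     (forall l : 'I_r, (i <= l)%N -> m l = 0%N) -> P (c *: 'X_[m])) ->
  forall F, is_form i s F -> P F.
Proof.
move=> P0 PD PX F hF; rewrite [F]mpolyE big_seq.
by apply: big_ind => // m /hF[? ?]; apply: PX.
Qed.

Lemma mnm_subK (m : 'X_{1..r}) (l : 'I_r) : (m l != 0)%N -> m = (U_(l) + (m - U_(l)))%MM.
Proof. by rewrite -lep1mP => h; rewrite addmC submK. Qed.

(** A monomial of positive degree is divisible by one of the allowed variables; each term is filed
    under one such variable. *)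
Lemma form_split i s F : is_form i s.+1 F ->
  exists2 G : 'I_r -> AT, (forall l, is_form i s (G l)) &
    F = \sum_(l : 'I_r | (l < i)%N) 'X_l * G l.
Proof.
move: F; apply: form_ind => [|F1 F2 [G1 h1 ->] [G2 h2 ->]|c m degm m0].
- by exists (fun=> 0) => [l|]; [exact: form0|rewrite big1 // => l _; rewrite mulr0].
- exists (fun l => G1 l + G2 l) => [l|]; first exact: formD.
  by rewrite -big_split /=; apply: eq_bigr => l _; rewrite mulrDr.
have [l ml] : exists l, (m l != 0)%N.
  apply/existsP; apply: contraT => /existsPn m00.
  suff: mdeg m = 0%N by rewrite degm.
  by rewrite mdegE big1 // => l _; have := m00 l; rewrite negbK => /eqP.
have li : (l < i)%N by rewrite ltnNge; apply: contraNN ml => /m0->.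
exists (fun j => if j == l then c *: 'X_[m - U_(l)] else 0) => [j|].
  case: eqP => _; last exact: form0.
  apply/formZ/formX => [|j' ij']; last by rewrite mnmBE m0.
  by apply/eqP; rewrite -eqSS -degm [in X in _ == X](mnm_subK ml) mdegD mdeg1.
rewrite (bigD1 l) //= eqxx big1 ?addr0 => [|j /andP[_ /negPf->]]; last by rewrite mulr0.
by rewrite -scalerAr -mpolyXD -mnm_subK.
Qed.

(** Terms divisible by ['X_l] go to [G], the others to [H], which therefore involves only the
    variables before [l]. *)
Lemma form_split_last (l : 'I_r) s F : is_form l.+1 s.+1 F ->
  exists G H, [/\ is_form l.+1 s G, is_form l s.+1 H & F = 'X_l * G + H].
Proof.
move: F; apply: form_ind.
- by exists 0, 0; split; rewrite ?mulr0 ?addr0; try apply: form0.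
- move=> F1 F2 [G1 [H1 [? ? ->]]] [G2 [H2 [? ? ->]]].
  by exists (G1 + G2), (H1 + H2); split; [exact: formD|exact: formD|rewrite mulrDr addrACA].
move=> c m degm m0; have [ml|ml] := eqVneq (m l) 0%N.
  exists 0, (c *: 'X_[m]); split; rewrite ?mulr0 ?add0r //; first exact: form0.
  apply/formZ/formX => // j; rewrite leq_eqVlt => /orP[/eqP /val_inj <- //|]; exact: m0.
exists (c *: 'X_[m - U_(l)]), 0; split; [|exact: form0|].
  apply/formZ/formX => [|j' ij']; last by rewrite mnmBE m0.
  by apply/eqP; rewrite -eqSS -degm [in X in _ == X](mnm_subK ml) mdegD mdeg1.
by rewrite addr0 -scalerAr -mpolyXD -mnm_subK.
Qed.

Lemma form_const i F : is_form i 0 F -> F = (F.@[f])%:MP.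
Proof.
move: F; apply: form_ind => [|F1 F2 e1 e2|c m /eqP]; first by rewrite meval0 mpolyC0.
  by rewrite mevalD mpolyCD -e1 -e2.
by rewrite mdeg_eq0 => /eqP-> _; rewrite mpolyX0 alg_mpolyC mevalC.
Qed.

Lemma form_none s F : is_form 0 s.+1 F -> F = 0.
Proof. by case/form_split => G _ ->; rewrite big1. Qed.

Lemma koszulW i j F : (i <= j)%N -> koszul i F -> koszul j F.
Proof.
move=> ij; apply: ideal_sub => _ [a [b [ab bi ->]]]; apply: ideal_gen.
by exists a, b; split=> //; apply: leq_trans ij.
Qed.

(** The coefficients of a Koszul relation are elements of the sequence up to sign. This turns
    membership in [koszul] into a congruence modulo [init i]. *)
Lemma koszul_coeff i F m : koszul i F -> init i F@_m.
Proof.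
move: F; apply: ideal_in_ind => [|F G ? ?|c _ _ [a [b [ab bi ->]]]].
- by rewrite mcoeff0; apply: ideal_in0.
- by rewrite mcoeffD; apply: ideal_inD.
rewrite /koszul_rel mulrBr -!scalerAr mcoeffB !mcoeffZ.
by apply: idealB; rewrite mulrC; apply/idealM/ideal_gen;
  [exists a => //; apply: ltn_trans bi|exists b].
Qed.

Definition regular_on := forall (i : 'I_r) (g : A), init i (f i * g) -> init i g.

(** Each coefficient is a combination of the [f a] with [a < i]; replacing these [f a] by ['X_a]
    raises the degree by one and keeps the value at [f]. *)
Lemma init_form_eval i s G : is_form i s G -> (forall m, init i G@_m) ->
  exists2 G', is_form i s.+1 G' & G'.@[f] = G.@[f].
Proof.
move=> hG Gi; rewrite (mpolyE G) big_seq.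
apply: (big_ind (fun F => exists2 G', is_form i s.+1 G' & G'.@[f] = F.@[f])) =>
  [|F1 F2 [G1 h1 e1] [G2 h2 e2]|m /hG[degm m0]].
- by exists 0; [exact: form0|].
- by exists (G1 + G2); [exact: formD|rewrite !mevalD e1 e2].
move: G@_m (Gi m); apply: ideal_in_ind => [|x y|c _ _ [a ai ->]].
- by exists 0; [exact: form0|rewrite scale0r].
- by case=> G1 h1 e1 [G2 h2 e2]; exists (G1 + G2); [exact: formD|rewrite scalerDl !mevalD e1 e2].
exists (c *: ('X_a * 'X_[m])); first by apply/formZ/form_mulX/formX.
by rewrite !mevalZ mevalM mevalXU mulrA.
Qed.

(** The values at [f] of forms of degree [s] in the first [l] variables make up the power
    [(init l)^s], so this says that [f l] is a nonzerodivisor modulo every such power. The premise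
    on Koszul relations is the outer induction hypothesis of [koszul_kernel]. *)
Lemma regular_form_eval (reg : regular_on) (l : 'I_r) :
  (forall s F, is_form l s F -> F.@[f] = 0 -> koszul l F) ->
  forall s g F, is_form l s F -> f l * g = F.@[f] ->
  exists2 G, is_form l s G & g = G.@[f].
Proof.
move=> kosl; elim=> [|s IHs] g F hF eqF.
  exists g%:MP; last by rewrite mevalC.
  by rewrite -[g%:MP]alg_mpolyC -mpolyX0; apply/formZ/formX => [|? _]; rewrite ?mdeg0 ?mnm0E.
have [F_ hF_ defF] := form_split hF.
(* Evaluating one linear factor of [F] gives a form of degree [s] with the same value, to which the
   induction hypothesis applies. *)
pose F' := \sum_(a : 'I_r | (a < l)%N) f a *: F_ a.
have hF' : is_form l s F' by apply: form_sum => a _; apply: formZ.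
have eqF' : F'.@[f] = F.@[f].
  rewrite defF !raddf_sum; apply: eq_bigr => a _ /=.
  by rewrite mevalZ mevalM mevalXU.
have [G hG eqG] := IHs g F' hF' (etrans eqF (esym eqF')).
have kosG : koszul l (f l *: G - F').
  apply: (kosl s); first by apply/formD/formN => //; apply: formZ.
  by rewrite mevalB mevalZ -eqG eqF eqF' subrr.
(* Modulo [init l] both [f l *: G - F'] and [F'] have zero coefficients, hence so does [f l *: G],
   and regularity passes this on to [G]. *)
have [G' hG' eqG'] : exists2 G', is_form l s.+1 G' & G'.@[f] = G.@[f].
  apply: init_form_eval => // m; apply: reg.
  have -> : f l * G@_m = (f l *: G - F')@_m + F'@_m by rewrite mcoeffB mcoeffZ subrK.
  apply: ideal_inD; first exact: koszul_coeff.
  rewrite raddf_sum; apply: ideal_in_sum => a al /=.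
  by rewrite mcoeffZ mulrC; apply/idealM/ideal_gen; exists a.
by exists G' => //; rewrite eqG' eqG.
Qed.

(** A regular sequence is of linear type: induction on the number [i] of elements, then on the
    degree [s]. *)
Lemma koszul_kernel (reg : regular_on) i s F :
  (i <= r)%N -> is_form i s F -> F.@[f] = 0 -> koszul i F.
Proof.
elim: i s F => [|i IHi] s F ir.
  case: s => [hF F0|s /form_none-> _]; last exact: ideal_in0.
  by rewrite (form_const hF) F0 mpolyC0; apply: ideal_in0.
pose l := Ordinal ir.
have kosl s' F' : is_form l s' F' -> F'.@[f] = 0 -> koszul l F' by apply/IHi/ltnW.
elim: s F => [|s IHs] F hF.
  by move=> F0; rewrite (form_const hF) F0 mpolyC0; apply: ideal_in0.
have [G [H [hG hH ->]]] := @form_split_last l s F hF.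
rewrite mevalD mevalM mevalXU => /eqP; rewrite addr_eq0 => /eqP eqGH.
(* Here [f l * G(f) = - H(f)], so cancelling [f l] modulo a power of [init l] expresses [G(f)]
   without the variable ['X_l]. *)
have [H' hH' eqH'] : exists2 H', is_form l s.+1 H' & G.@[f] = H'.@[f].
  by apply: (regular_form_eval reg kosl (formN hH)); rewrite mevalN.
have [E hE defH'] := form_split hH'.
pose G' := G - \sum_(a : 'I_r | (a < l)%N) f a *: E a.
have kosG' : koszul i.+1 G'.
  apply: IHs.
    apply/formD/formN => //; apply: form_sum => a _.
    by apply: formZ; apply: formW (hE a); apply: leqnSn.
  apply/eqP; rewrite mevalB eqH' defH' subr_eq0 !raddf_sum; apply/eqP/eq_bigr => a _ /=.
  by rewrite mevalZ mevalM mevalXU.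
(* The three summands are in [koszul] for different reasons: [G'] has degree [s] and value 0, the
   middle sum consists of Koszul relations, and [f l *: H' + H] has value 0 and does not involve
   ['X_l]. *)
have -> : 'X_l * G + H = 'X_l * G' + \sum_(a : 'I_r | (a < l)%N) E a * koszul_rel a l
                        + (f l *: H' + H).
  rewrite [RHS]addrA; congr (_ + H).
  rewrite /G' mulrBr -!addrA -[LHS]addr0; congr (_ + _); apply/esym.
  rewrite defH' scaler_sumr mulr_sumr -sumrN -!big_split /= big1 // => a _.
  by rewrite /koszul_rel -!mul_mpolyC; ring.
apply: ideal_inD.
  apply: ideal_inD; first exact: idealM.
  apply: ideal_in_sum => a al; apply/idealM/ideal_gen.
  by exists a, l; split=> //=.
apply: (koszulW (leqnSn i)); apply: (kosl s.+1).
  by apply: formD => //; apply: formZ.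
by rewrite mevalD mevalZ -eqH' eqGH addNr.
Qed.

End Koszul.

(** * Multi-indices and supports *)

Section Multiindices.
Variables (n a : nat).
Implicit Types (j : J n a) (m : 'X_{1..n}).

Lemma jent0 j : jent j 0 = 0%N.
Proof. by []. Qed.

Lemma jent_last j : (0 < n)%N -> jent j n = a.
Proof.
by move=> n0; rewrite /jent nth_default //= size_map size_tuple prednK.
Qed.

Lemma jent_le j i : (jent j i <= a)%N.
Proof.
rewrite /jent; case: i => [|i] //=.
have [lti|gei] := ltnP i (size (val j)); last by rewrite nth_default ?size_map.
by rewrite (nth_map ord0) // -ltnS.
Qed.

Lemma jent_leS j (i : 'I_n) : (jent j i <= jent j i.+1)%N.
Proof.
have [lti|gei] := ltnP i.+1 n; first exact: jent_homo.
have -> : i.+1 = n by apply/eqP; rewrite eqn_leq gei ltn_ord.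
by rewrite jent_last ?jent_le //; apply: leq_ltn_trans (ltn_ord i).
Qed.

Lemma jentS j (i : 'I_n) : jent j i.+1 = (jent j i + jmnm j i)%N.
Proof. by rewrite mnmE subnKC ?jent_leS. Qed.

(** The entries of a multi-index are the partial sums of the exponents of its monomial; this makes
    [jmnm] a bijection onto the monomials of degree [a]. *)
Lemma jent_psum j i : (i <= n)%N -> jent j i = (\sum_(t < n | t < i) jmnm j t)%N.
Proof.
elim: i => [|i IHi] lti; first by rewrite big_pred0.
rewrite (jentS j (Ordinal lti)) /= IHi 1?ltnW // [RHS](bigD1 (Ordinal lti)) //= addnC.
by congr (_ + _)%N; apply: eq_bigl => t; rewrite -val_eqE /= ltnS ltn_neqAle andbC.
Qed.

Lemma mdeg_jmnm j : (0 < n)%N -> mdeg (jmnm j) = a.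
Proof.
move=> n0; rewrite -[RHS](jent_last j n0) jent_psum // mdegE.
by apply: eq_bigl => t; rewrite ltn_ord.
Qed.

Lemma jmnm_inj : injective (@jmnm n a).
Proof.
move=> j j' eqj; apply/val_inj/eq_from_tnth => i; apply/val_inj.
have lti : (i.+1 <= n)%N by have := ltn_ord i; lia.
have: jent j i.+1 = jent j' i.+1 by rewrite !jent_psum // eqj.
by rewrite /jent /= !(nth_map ord0) ?size_tuple // -!tnth_nth.
Qed.

Lemma jmnm_surj m : (0 < n)%N -> mdeg m = a -> exists j, jmnm j = m.
Proof.
move=> n0 degm; pose ps i := (\sum_(t < n | t < i) m t)%N.
have ps_homo i i' : (i <= i')%N -> (ps i <= ps i')%N.
  move=> le_ii'; rewrite /ps [X in (_ <= X)%N](bigID (fun t : 'I_n => t < i)%N) /=.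
  rewrite -[X in (X <= _)%N]addn0; apply: leq_add => //.
  by apply/eq_leq/eq_bigl => t; case: (ltnP t i) => ti; rewrite ?andbT ?andbF // (leq_trans ti).
have ps_le i : (ps i <= a)%N.
  rewrite -degm mdegE [X in (_ <= X)%N](bigID (fun t : 'I_n => t < i)%N) /=; exact: leq_addr.
(* The partial sums are at most [a] by [ps_le], so [inord] never falls back on its default. *)
pose tup := [tuple (inord (ps i.+1) : 'I_a.+1) | i < n.-1].
have nth_tup i : (i < n.-1)%N -> nth 0%N [seq val i | i <- tup] i = ps i.+1.
  move=> lti; rewrite (nth_map ord0) ?size_tuple // -(tnth_nth ord0 _ (Ordinal lti)).
  by rewrite tnth_mktuple /= inordK // ltnS.
have srt : sorted leq [seq val i | i <- tup].
  apply: (@path_sorted _ _ 0%N); apply/(pathP 0%N) => i.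
  rewrite size_map size_tuple => lti; rewrite nth_tup //; case: i lti => [|i] lti //=.
  by rewrite nth_tup ?(ltnW lti) //; apply: ps_homo.
pose j : J n a := Sub tup srt.
have jentE i : (i <= n)%N -> jent j i = ps i.
  case: i => [|i] lti; first by rewrite /ps big_pred0.
  have [lti'|gei] := ltnP i n.-1.
    by rewrite -nth_tup //; apply: (@set_nth_default _ _ 0%N a);
      rewrite -[X in (_ < X)%N]/(size [seq val i | i <- val j]).+1 size_map size_tuple.
  (* The remaining index is [n], where [jent] returns its default [a], the sum of all exponents. *)
  have -> : i.+1 = n by apply/eqP; rewrite eqn_leq lti -[X in (X <= _)%N](prednK n0) ltnS.
  rewrite jent_last // -degm mdegE /ps; apply: eq_bigl => t; by rewrite ltn_ord.
exists j; apply/mnmP => i; rewrite mnmE (jentE _ (ltn_ord i)) (jentE _ (ltnW (ltn_ord i))).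
rewrite {1}/ps (bigD1 i) //= /ps; set u := (X in (_ + X - _)%N); set v := (X in (_ - X)%N).
suff -> : u = v by rewrite addnK.
by apply: eq_bigl => t; rewrite -val_eqE /= ltnS [RHS]ltn_neqAle andbC.
Qed.

(** One formula covers the boundary entries: at [i = 0] truncated subtraction keeps 0, and at
    [i = n] nothing is subtracted since [s < n]. *)
Lemma jent_jshift j (s : 'I_n) i : (0 < n)%N -> (i <= n)%N ->
  jent (jshift j s) i = (jent j i - (i <= s))%N.
Proof.
move=> n0; case: i => [|i] lti //=.
have [lti'|gei] := ltnP i n.-1; last first.
  have -> : i.+1 = n by apply/eqP; rewrite eqn_leq lti -[X in (X <= _)%N](prednK n0) ltnS.
  by rewrite !jent_last // leqNgt ltn_ord subn0.
rewrite -[LHS]/(nth a [seq val i0 | i0 <-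
  [tuple (inord (jent j i.+1 - (i < s)) : 'I_a.+1) | i < n.-1]] i).
rewrite (nth_map ord0) ?size_tuple // -(tnth_nth ord0 _ (Ordinal lti')).
rewrite tnth_mktuple /= inordK // ltnS; apply: leq_trans (leq_subr _ _) (jent_le _ _).
Qed.

(** Lowering the first entries by one moves one unit of exponent from the first variable to the
    variable [s]. The additive form avoids truncated subtraction. *)
Lemma jmnm_jshift j (i0 s : 'I_n) : val i0 = 0%N -> (1 <= jent j 1)%N ->
  (U_(i0) + jmnm (jshift j s) = jmnm j + U_(s))%MM.
Proof.
move=> i00 j1; have n0 : (0 < n)%N by apply: leq_ltn_trans (ltn_ord s).
apply/mnmP => i; rewrite !mnmDE !mnm1E !mnmE.
rewrite (jent_jshift _ _ n0 (ltn_ord i)) (jent_jshift _ _ n0 (ltnW (ltn_ord i))).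
rewrite -!val_eqE i00 /=; have := jent_leS j i.
case: i => [[|i] lti] /=; first by rewrite jent0; move: (jent j 1) j1; case: (val s) => [|?]; lia.
have := jent_homo j (isT : (1 <= i.+1)%N) lti; move: (jent j 1) (jent j i.+1) (jent j i.+2) j1.
move: (val s) => s'; lia.
Qed.

(** The columns of [B] correspond to the monomials [m] of degree [a - 1], the row [s] holding the
    variable of [m * x_s]. The witness is the multi-index of [m] times the first variable. *)
Lemma jshift_column m : (mdeg m).+1 = a -> (0 < n)%N ->
  exists j, (1 <= jent j 1)%N /\ forall s, jmnm (jshift j s) = (m + U_(s))%MM.
Proof.
move=> degm n0; pose i0 := Ordinal n0.
have [|j defj] := @jmnm_surj (m + U_(i0))%MM n0; first by rewrite mdegD mdeg1 addn1.
have j1 : (1 <= jent j 1)%N.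
  by rewrite (jentS j i0) defj mnmDE mnm1E eqxx addn1 addnS.
exists j; split=> // s; apply: (@addmI _ U_(i0)%MM).
by rewrite (jmnm_jshift s (erefl : val i0 = 0%N) j1) defj addmA [(U_(i0) + m)%MM]addmC.
Qed.

End Multiindices.

(** * Supports of polynomials in the [x_i], and joint supports in the [x_i] and [t_l] *)

Section Supports.
Variables (k : comNzRingType) (n r : nat).
Local Notation R := {mpoly k[n]}.
Local Notation Rt := {mpoly {mpoly k[n]}[r]}.

Definition supp (P : pred 'X_{1..n}) (p : R) := {subset msupp p <= P}.

Lemma supp0 P : supp P 0.
Proof. by move=> m; rewrite msupp0. Qed.

Lemma suppD P p q : supp P p -> supp P q -> supp P (p + q).
Proof. by move=> hp hq m /msuppD_le; rewrite mem_cat => /orP[/hp|/hq]. Qed.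

Lemma suppN P p : supp P p -> supp P (- p).
Proof. by move=> hp m; rewrite (perm_mem (msuppN _)) => /hp. Qed.

Lemma supp_sum P (I : Type) (s : seq I) (Q : pred I) (F : I -> R) :
  (forall i, Q i -> supp P (F i)) -> supp P (\sum_(i <- s | Q i) F i).
Proof. by move=> H; apply: big_ind => //; [exact: supp0|exact: suppD]. Qed.

Lemma suppM P Q (S : pred 'X_{1..n}) p q : supp P p -> supp Q q ->
  (forall m m', m \in P -> m' \in Q -> (m + m')%MM \in S) -> supp S (p * q).
Proof. by move=> hp hq PQS m /msuppM_le /allpairsP[[m1 m2] [/hp ? /hq ? ->]]; apply: PQS. Qed.

Lemma suppX (P : pred 'X_{1..n}) c m : m \in P -> supp P (c *: 'X_[m]).
Proof. by move=> Pm m' /msuppZ_le; rewrite msuppX inE => /eqP->. Qed.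

Lemma supp_ind (P : pred 'X_{1..n}) (Q : R -> Prop) : Q 0 ->
  (forall p q, Q p -> Q q -> Q (p + q)) ->
  (forall c m, m \in P -> Q (c *: 'X_[m])) -> forall p, supp P p -> Q p.
Proof.
move=> Q0 QD QX p hp; rewrite [p]mpolyE big_seq.
by apply: big_ind => // m /hp; apply: QX.
Qed.

Lemma supp_split (P : pred 'X_{1..n}) p :
  exists q q', [/\ supp P q, supp (predC P) q' & p = q + q'].
Proof.
have: supp predT p by [].
move: p; apply: supp_ind => [|p p' [q1 [q2 [? ? ->]]] [q1' [q2' [? ? ->]]]|c m _].
- by exists 0, 0; split; rewrite ?addr0; try apply: supp0.
- by exists (q1 + q1'), (q2 + q2'); split; [exact: suppD|exact: suppD|rewrite addrACA].
have [Pm|nPm] := boolP (P m).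
  by exists (c *: 'X_[m]), 0; split; [exact: suppX|exact: supp0|rewrite addr0].
by exists 0, (c *: 'X_[m]); split; [exact: supp0|exact: suppX|rewrite add0r].
Qed.

Lemma supp_disjoint P p : supp P p -> supp (predC P) p -> p = 0.
Proof.
move=> hp hp'; apply/mpolyP => m; rewrite mcoeff0; apply: memN_msupp_eq0.
apply/negP => mp; have := hp' m mp; rewrite inE /=.
by have := hp m mp; rewrite -topredE /= => ->.
Qed.

(** The set of allowed [x]-monomials varies with the [t]-monomial [b], so that conditions on the
    grading with [t_l] in degree [- a l] can be expressed. *)
Definition bisupp (P : 'X_{1..r} -> pred 'X_{1..n}) (p : Rt) := forall b, supp (P b) p@_b.

Lemma bisupp0 P : bisupp P 0.
Proof. by move=> b; rewrite mcoeff0; apply: supp0. Qed.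

Lemma bisuppD P p q : bisupp P p -> bisupp P q -> bisupp P (p + q).
Proof. by move=> hp hq b; rewrite mcoeffD; apply: suppD. Qed.

Lemma bisuppB P p q : bisupp P p -> bisupp P q -> bisupp P (p - q).
Proof. by move=> hp hq b; rewrite mcoeffB; apply/suppD/suppN. Qed.

Lemma bisupp_sum P (I : Type) (s : seq I) (Q : pred I) (F : I -> Rt) :
  (forall i, Q i -> bisupp P (F i)) -> bisupp P (\sum_(i <- s | Q i) F i).
Proof. by move=> H; apply: big_ind => //; [exact: bisupp0|exact: bisuppD]. Qed.

Lemma bisuppM P Q (S : 'X_{1..r} -> pred 'X_{1..n}) p q : bisupp P p -> bisupp Q q ->
  (forall b m b' m', m \in P b -> m' \in Q b' -> (m + m')%MM \in S (b + b')%MM) ->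
  bisupp S (p * q).
Proof.
move=> hp hq PQS b; rewrite mcoeffM; apply: supp_sum => -[b1 b2] /= /eqP eb.
by apply: (suppM (hp b1) (hq b2)) => m m' Pm Qm'; rewrite [X in S X]eb; apply: PQS.
Qed.

Lemma bisuppX (P : 'X_{1..r} -> pred 'X_{1..n}) p b : supp (P b) p -> bisupp P (p *: 'X_[b]).
Proof.
move=> hp b'; rewrite mcoeffZ mcoeffX; case: eqP => [<-|_]; first by rewrite mulr1.
by rewrite mulr0; apply: supp0.
Qed.

Lemma bisupp_ind (P : 'X_{1..r} -> pred 'X_{1..n}) (Q : Rt -> Prop) : Q 0 ->
  (forall p q, Q p -> Q q -> Q (p + q)) ->
  (forall c m b, m \in P b -> Q ((c *: 'X_[m]) *: 'X_[b])) -> forall p, bisupp P p -> Q p.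
Proof.
move=> Q0 QD QX p hp; rewrite [p]mpolyE; apply: big_ind => // b _.
move: p@_b (hp b); apply: supp_ind => [|q q'|c m]; first by rewrite scale0r.
  by rewrite scalerDl; apply: QD.
exact: QX.
Qed.

Lemma bisupp_split (P : 'X_{1..r} -> pred 'X_{1..n}) p :
  exists q q', [/\ bisupp P q, bisupp (fun b => predC (P b)) q' & p = q + q'].
Proof.
have: bisupp (fun=> predT) p by [].
move: p; apply: bisupp_ind => [|p p' [q1 [q2 [? ? ->]]] [q1' [q2' [? ? ->]]]|c m b _].
- by exists 0, 0; split; rewrite ?addr0; try apply: bisupp0.
- by exists (q1 + q1'), (q2 + q2'); split; [exact: bisuppD|exact: bisuppD|rewrite addrACA].
have [q [q' [? ? ->]]] := supp_split (P b) (c *: 'X_[m]).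
by exists (q *: 'X_[b]), (q' *: 'X_[b]); rewrite -scalerDl; split=> //; apply: bisuppX.
Qed.

Lemma bisupp_disjoint P p : bisupp P p -> bisupp (fun b => predC (P b)) p -> p = 0.
Proof. by move=> hp hp'; apply/mpolyP => b; rewrite mcoeff0; apply: supp_disjoint. Qed.

End Supports.

(** * The Rees algebra of M *)

Section Truncation.
Variables (k : fieldType) (n r : nat).
Local Notation R := {mpoly k[n]}.

Lemma mnm_split_deg c (m : 'X_{1..n}) : (c <= mdeg m)%N ->
  exists m1 m2 : 'X_{1..n}, m = (m1 + m2)%MM /\ mdeg m1 = c.
Proof.
elim: c => [|c IHc] le_c; first by exists 0%MM, m; rewrite add0m mdeg0.
have [m1 [m2 [defm deg1]]] := IHc (ltnW le_c).
have [l ml] : exists l, (m2 l != 0)%N.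
  apply/existsP; apply: contraTT le_c => /existsPn m20.
  suff: mdeg m2 = 0%N by rewrite defm mdegD deg1 => ->; rewrite addn0 ltnn.
  by rewrite mdegE big1 // => l _; have := m20 l; rewrite negbK => /eqP.
exists (m1 + U_(l))%MM, (m2 - U_(l))%MM; split; last by rewrite mdegD mdeg1 deg1 addn1.
by rewrite -addmA -mnm_subK.
Qed.

Lemma mnm_mdegS c (m : 'X_{1..n}) : mdeg m = c.+1 ->
  exists l m', m = (U_(l) + m')%MM /\ mdeg m' = c.
Proof.
move=> degm; have [|m1 [m2 [defm /eqP/mdeg1P[l /eqP def1]]]] := @mnm_split_deg 1 m.
  by rewrite degm.
exists l, m2; rewrite -def1; split=> //.
by apply/eqP; rewrite -eqSS -degm defm mdegD def1 mdeg1.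
Qed.

Lemma prod_max_ideal c (m : 'X_{1..n}) : mdeg m = c ->
  exists2 u : 'I_c -> R, (forall i, max_ideal (u i)) & 'X_[m] = \prod_i u i.
Proof.
elim: c m => [|c IHc] m degm.
  exists (fun=> 0) => [[]//|]; rewrite big_ord0.
  by move/eqP: degm; rewrite mdeg_eq0 => /eqP->; rewrite mpolyX0.
have [l [m' [-> degm']]] := mnm_mdegS degm.
have [u hu defX] := IHc m' degm'.
exists (fun i => if unlift ord0 i is Some j then u j else 'X_l).
  by move=> i; case: unlift => [j|] //; apply: ideal_gen; exists l.
rewrite big_ord_recl unlift_none mpolyXD defX; congr (_ * _).
by apply: eq_bigr => i _; rewrite liftK.
Qed.

(** A monomial of degree at least [c] has a divisor of degree [c], which is a product of [c]
    variables; conversely each factor from the maximal ideal contributes degree at least 1. *)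
Lemma ideal_exp_maxP c (u : R) :
  ideal_exp (@max_ideal k n) c u <-> supp [pred m | (c <= mdeg m)%N] u.
Proof.
split.
  move: u; apply: ideal_in_ind => [|p q|p _ _ [u hu ->]]; [exact: supp0|exact: suppD|].
  have supp_prod : supp [pred m | (c <= mdeg m)%N] (\prod_(i < c) u i).
    elim: c u hu => [|c IHc] u hu; first by move=> m; rewrite !inE.
    have supp_max (x : R) : max_ideal x -> supp [pred m : 'X_{1..n} | (1 <= mdeg m)%N] x.
      move: x; apply: ideal_in_ind => [|p' q|c' _ _ [l ->]].
      - exact: supp0.
      - exact: suppD.
      apply: (suppM (P := predT) (Q := [pred m | (1 <= mdeg m)%N])) => [m _||] //.
        by move=> m; rewrite msuppX !inE => /eqP->; rewrite mdeg1.
      by move=> m m' _ /[!inE] h; rewrite mdegD (leq_trans h) ?leq_addl.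
    have supp_tl := IHc (fun i => u (lift ord0 i)) (fun i => hu _).
    rewrite big_ord_recl; apply: (suppM (supp_max _ (hu ord0)) supp_tl) => m m'.
    by rewrite !inE mdegD; lia.
  apply: (suppM (P := predT) _ supp_prod) => //.
  by move=> m m' _ /[!inE] h; rewrite mdegD (leq_trans h) ?leq_addl.
move: u; apply: supp_ind => [|p q|b m].
- exact: ideal_in0.
- exact: ideal_inD.
rewrite inE => /mnm_split_deg [m1 [m2 [-> deg1]]].
rewrite mpolyXD mulrC -mul_mpolyC mulrA; apply: ideal_in_gen => //.
by have [v hv ->] := prod_max_ideal deg1; exists v.
Qed.

Lemma ideal_rangeP (A : comNzRingType) (f : 'I_r -> A) g :
  ideal (fun u => exists l : 'I_r, u = f l) g <-> exists c : 'I_r -> A, g = \sum_l c l * f l.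
Proof.
split; last by case=> c ->; apply: ideal_in_sum => l _; apply: ideal_in_gen => //; exists l.
move: g; apply: ideal_in_ind => [|x y [c ->] [c' ->]|c _ _ [l ->]].
- by exists (fun=> 0); rewrite big1 // => l _; rewrite mul0r.
- by exists (fun l => c l + c' l); rewrite -big_split; apply: eq_bigr => l _ /=; rewrite mulrDl.
exists (fun j => if j == l then c else 0).
by rewrite (bigD1 l) //= eqxx big1 ?addr0 // => j /negPf->; rewrite mul0r.
Qed.

Variables (f : 'I_r -> R) (e : 'I_r -> nat) (d : nat).
Hypothesis hom : forall l, f l \is (e l).-homog.

Lemma homog_supp l : supp [pred m | mdeg m == e l] (f l).
Proof. by move=> m /(dhomog_mf (hom l)) em; rewrite inE em. Qed.

Lemma ItruncP (le_ed : forall l, (e l <= d)%N) g :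
  Itrunc f d g <-> exists2 u : 'I_r -> R,
    (forall l, supp [pred m | (adeg e d l <= mdeg m)%N] (u l)) & g = \sum_l u l * f l.
Proof.
split=> [[/ideal_rangeP[c defg] deg_g]|[u hu ->]].
  have /fin_all_exists2 [u hu hu'] : forall l, exists2 u : R,
      supp [pred m | (adeg e d l <= mdeg m)%N] u
      & supp [pred m | (mdeg m < adeg e d l)%N] (c l - u).
    move=> l; have [u [u' [hu hu' ->]]] := supp_split [pred m | (adeg e d l <= mdeg m)%N] (c l).
    by exists u => //; rewrite addrC addKr => m /hu'; rewrite !inE ltnNge.
  exists u => //; apply/eqP; rewrite -subr_eq0; apply/eqP.
  (* The difference between [g] and the truncated combination has only terms of degree at least [d],
     and equally only terms of degree below [d]. *)
  apply: (supp_disjoint (P := [pred m | (d <= mdeg m)%N])).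
    apply/suppD/suppN => [m /deg_g //|]; apply: supp_sum => l _.
    apply: (suppM (hu l) (@homog_supp l)) => m m' /[!inE]; rewrite mdegD /adeg; lia.
  rewrite defg -sumrB; apply: supp_sum => l _; rewrite -mulrBl.
  apply: (suppM (hu' l) (@homog_supp l)) => m m' /[!inE]; rewrite /= mdegD /adeg.
  have := le_ed l; lia.
split; first by apply/ideal_rangeP; exists u.
move=> m; apply: (@supp_sum _ _ [pred m | (d <= mdeg m)%N]) => l _.
by apply: (suppM (hu l) (@homog_supp l)) => m1 m2 /[!inE]; rewrite mdegD /adeg; lia.
Qed.

End Truncation.

(** * The Rees algebra as a nonnegative graded part, and the map [phi] onto it *)

Section ReesOfModule.
Variables (k : fieldType) (n r : nat) (a : 'I_r -> nat).
Local Notation R := {mpoly k[n]}.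
Local Notation Rt := {mpoly {mpoly k[n]}[r]}.
Hypothesis n0 : (0 < n)%N.

Definition weight (b : 'X_{1..r}) : nat := (\sum_l b l * a l)%N.

Lemma weight0 : weight 0 = 0%N.
Proof. by rewrite /weight big1 // => l _; rewrite mnm0E. Qed.

Lemma weightD b b' : weight (b + b') = (weight b + weight b')%N.
Proof. by rewrite -big_split; apply: eq_bigr => l _; rewrite mnmDE mulnDl. Qed.

Lemma weight1 l : weight U_(l) = a l.
Proof.
rewrite /weight (bigD1 l) //= mnm1E eqxx mul1n big1 ?addn0 // => j jl.
by rewrite mnm1E eq_sym (negPf jl).
Qed.

(** With [t_l] in degree [- a l], these are the [m] for which [x^m t^b] has degree at least [c]; the
    subtraction is avoided. *)
Definition wge (c : nat) (b : 'X_{1..r}) : pred 'X_{1..n} :=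
  [pred m : 'X_{1..n} | (weight b + c <= mdeg m)%N].

Lemma ReesM_scale c p : ReesM a p -> ReesM a ((c : R) *: p : Rt).
Proof. by move=> Mp; rewrite -mulr_algl; apply: subalg_mul => //; apply: subalg_scalar. Qed.

Lemma ReesM0 : ReesM a (0 : Rt).
Proof. by rewrite -[0](scale0r 1); apply: subalg_scalar. Qed.

(** Each [t_l] in [b] is paired with a divisor of [m] of degree [a l], which gives a generator; what
    is left of [m] at the end is a scalar. *)
Lemma ReesM_term (m : 'X_{1..n}) b : (weight b <= mdeg m)%N ->
  ReesM a (('X_[m] : R) *: 'X_[b] : Rt).
Proof.
move defs: (mdeg b) => s; elim: s b m defs => [|s IHs] b m degb.
  by move/eqP: degb; rewrite mdeg_eq0 => /eqP-> _; rewrite mpolyX0; apply: subalg_scalar.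
have [l [b' [-> degb']]] := mnm_mdegS degb.
rewrite weightD weight1 => le_w.
have [|m1 [m2 [defm deg1]]] := @mnm_split_deg n (a l) m.
  by apply: leq_trans (leq_addr _ _) le_w.
have [j defj] := jmnm_surj n0 deg1.
rewrite defm !mpolyXD -scalerA scalerAr scalerAl.
apply: subalg_mul; first by apply: subalg_gen; exists l, j; rewrite defj.
by apply: IHs => //; move: le_w; rewrite defm mdegD deg1 leq_add2l.
Qed.

Lemma ReesMP (p : Rt) : ReesM a p <-> bisupp (wge 0) p.
Proof.
split.
  elim=> [c|_ [l [j ->]]|x y _ hx _ hy|x y _ hx _ hy].
  - rewrite -[1]mpolyX0; apply: bisuppX => m _.
    by rewrite inE weight0.
  - apply: bisuppX; rewrite -[X in supp _ X]scale1r; apply: suppX.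
    by rewrite inE weight1 addn0 mdeg_jmnm.
  - exact: bisuppD.
  - apply: (bisuppM hx hy) => b m b' m'; rewrite !inE weightD mdegD !addn0.
    exact: leq_add.
move: p; apply: bisupp_ind => [|p q|c m b]; [exact: ReesM0|exact: subalg_add|].
rewrite inE addn0 -[c *: _]mul_mpolyC -scalerA => h; apply: ReesM_scale; exact: ReesM_term.
Qed.

Local Notation S := {mpoly {mpoly k[#|{: Tidx n a}|]}[n]}.
Implicit Types (ws : seq (Tidx n a)) (m : 'X_{1..n}).

(** Monomials in the [T] variables are written as words, so that single factors can be isolated and
    exchanged. The exponents [jtotal] and [ttotal] describe their images under [phi]. *)
Definition Tmon ws : {mpoly k[#|{: Tidx n a}|]} := \prod_(w <- ws) Tvar k (tagged w).
Definition Smon m ws : S := (Tmon ws)%:MP * 'X_[m].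
Definition jtotal ws : 'X_{1..n} := (\sum_(w <- ws) jmnm (tagged w))%MM.
Definition ttotal ws : 'X_{1..r} := (\sum_(w <- ws) U_(tag w))%MM.

Lemma phiC h : phi k n a h%:MP = phiT k n a h.
Proof. exact: mmapC. Qed.

Lemma phiT_Tvar (w : Tidx n a) :
  phiT k n a (Tvar k (tagged w)) = ('X_[jmnm (tagged w)] : R) *: 'X_(tag w).
Proof. by rewrite /Tvar taggedK [LHS]mmapX mmap1U enum_rankK. Qed.

Lemma phi_scalar c : phi k n a c%:MP%:MP = c%:MP%:MP.
Proof. by rewrite phiC [LHS]mmapC. Qed.

Lemma phiX m : phi k n a 'X_[m] = ('X_[m])%:MP.
Proof.
rewrite [LHS]mmapX /mmap1 (mpolyXE_id _ m) rmorph_prod.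
by apply: eq_bigr => i _; rewrite rmorphXn.
Qed.

Lemma phiT_Tmon ws :
  phiT k n a (Tmon ws) = ('X_[jtotal ws] : R) *: 'X_[ttotal ws].
Proof.
rewrite /Tmon /jtotal /ttotal; elim: ws => [|w ws IHws].
  by rewrite !big_nil rmorph1 !mpolyX0 scale1r.
rewrite !big_cons rmorphM IHws phiT_Tvar !mpolyXD.
by rewrite -scalerA scalerAr scalerAl.
Qed.

Lemma phi_Smon m ws :
  phi k n a (Smon m ws) = ('X_[m + jtotal ws] : R) *: 'X_[ttotal ws].
Proof. by rewrite /Smon rmorphM phiC phiX phiT_Tmon mulrC mul_mpolyC scalerA -mpolyXD. Qed.

Lemma Tmon_surj (m : 'X_{1..#|{: Tidx n a}|}) : exists ws, 'X_[m] = Tmon ws.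
Proof.
move defs: (mdeg m) => s; elim: s m defs => [|s IHs] m degm.
  exists [::]; rewrite /Tmon big_nil; move/eqP: degm.
  by rewrite mdeg_eq0 => /eqP->; rewrite mpolyX0.
have [v [m' [-> /IHs[ws defX]]]] := mnm_mdegS degm.
exists (enum_val v :: ws); rewrite /Tmon big_cons mpolyXD defX; congr (_ * _).
by rewrite /Tvar taggedK enum_valK.
Qed.

Lemma Smon_ind (Q : S -> Prop) : Q 0 -> (forall p q, Q p -> Q q -> Q (p + q)) ->
  (forall c m ws, Q (c%:MP%:MP * Smon m ws)) -> forall s, Q s.
Proof.
move=> Q0 QD QX s; have: bisupp (fun=> predT) s by [].
move: s; apply: bisupp_ind => // c mT m _.
have [ws ->] := Tmon_surj mT; have := QX c m ws.
by rewrite /Smon -!mul_mpolyC mpolyCM mulrA.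
Qed.

Lemma phi_ReesM s : ReesM a (phi k n a s).
Proof.
move: s; apply: Smon_ind => [|p q hp hq|c m ws].
- by rewrite rmorph0; apply: ReesM0.
- by rewrite rmorphD; apply: (subalg_add hp hq).
rewrite (rmorphM (phi k n a)) phi_scalar phi_Smon mul_mpolyC; apply/ReesM_scale/ReesM_term.
rewrite /jtotal /ttotal mdegD; apply: leq_trans (leq_addl _ _).
elim: ws => [|w ws IHws]; first by rewrite !big_nil weight0 mdeg0.
by rewrite !big_cons weightD mdegD weight1 mdeg_jmnm // leq_add2l.
Qed.

Lemma phi_surj (p : Rt) : ReesM a p -> exists s, phi k n a s = p.
Proof.
elim=> [c|_ [l [j ->]]|x y _ [s <-] _ [s' <-]|x y _ [s <-] _ [s' <-]].
- have: supp predT c by [].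
  rewrite alg_mpolyC.
  move: c; apply: supp_ind => [|p' q [s es] [s' es']|c m _].
  + by exists 0; rewrite rmorph0 mpolyC0.
  + by exists (s + s'); rewrite rmorphD es es' mpolyCD.
  by exists (c%:MP%:MP * 'X_[m]); rewrite rmorphM phi_scalar phiX -mul_mpolyC mpolyCM.
- by exists (Tvar k j)%:MP; rewrite phiC (phiT_Tvar (Tagged (fun l => J n (a l)) j)).
- by exists (s + s'); rewrite rmorphD.
- by exists (s * s'); rewrite rmorphM.
Qed.

End ReesOfModule.

(** * The kernel of Psi *)

Section PsiKernel.
Variables (k : fieldType) (n r : nat) (f : 'I_r -> {mpoly k[n]}).
Local Notation R := {mpoly k[n]}.
Local Notation Rt := {mpoly {mpoly k[n]}[r]}.

Lemma PsiX (c : R) m : Psi f (c *: 'X_[m]) = (c * \prod_l f l ^+ m l) *: 'X^(mdeg m).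
Proof.
rewrite [LHS]mmapZ mmapX /mmap1 mul_polyC -scalerA; congr (_ *: _).
by rewrite mdegE -prodrXr -scaler_prod; apply: eq_bigr => l _; rewrite exprZn.
Qed.

(** On forms of fixed degree [Psi] is evaluation at [f], which links its kernel to
    [koszul_kernel]. *)
Lemma Psi_form s (F : Rt) : is_form r s F -> Psi f F = F.@[f] *: 'X^s.
Proof.
move: F; apply: form_ind => [|F G|c m <- _]; first by rewrite rmorph0 meval0 scale0r.
  by rewrite rmorphD mevalD scalerDl => -> ->.
by rewrite PsiX mevalZ mevalX.
Qed.

Lemma form_pihomog s (F : Rt) : is_form r s (pihomog mdeg s F).
Proof.
move=> m /(dhomog_mf (pihomogP mdeg s F)) ->; split=> // l.
by rewrite leqNgt ltn_ord.
Qed.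

(** As [Psi] preserves the degree in the [t_l], every homogeneous component of [p] is itself in the
    kernel. *)
Lemma Psi_kernel (reg : regular_on f) (p : Rt) : Psi f p = 0 -> koszul f r p.
Proof.
have defp := pihomog_partitionE (leqnn (msize p)).
move=> Psi0; rewrite defp; apply: ideal_in_sum => s _.
apply: (koszul_kernel reg (leqnn r) (@form_pihomog s p)).
have := congr1 (fun q : {poly R} => q`_s) Psi0.
rewrite {1}defp raddf_sum /= coef0 coef_sum (bigD1 s) //= big1 ?addr0 => [|i neq_is].
  by rewrite (Psi_form (@form_pihomog s p)) coefZ coefXn eqxx mulr1.
by rewrite (Psi_form (@form_pihomog i p)) coefZ coefXn eq_sym val_eqE (negPf neq_is) mulr0.
Qed.

Section Linear.
Variables (a : 'I_r -> nat).
Hypothesis n0 : (0 < n)%N.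

Lemma sum_jmnm c (q : R) : q \is c.-homog ->
  \sum_(v : J n c) q@_(jmnm v) *: 'X_[jmnm v] = q.
Proof.
move=> homq; apply/mpolyP => m; rewrite raddf_sum /=.
have [degm|ndegm] := eqVneq (mdeg m) c.
  have [j <-] := jmnm_surj n0 degm.
  rewrite (bigD1 j) //= mcoeffZ mcoeffX eqxx mulr1 big1 ?addr0 // => v neq_vj.
  by rewrite mcoeffZ mcoeffX (inj_eq (@jmnm_inj _ _)) (negPf neq_vj) mulr0.
rewrite (dhomog_nemf_coeff homq ndegm) big1 // => v _.
rewrite mcoeffZ mcoeffX; case: eqP => [vm|_]; last by rewrite mulr0.
by rewrite -vm mdeg_jmnm ?eqxx in ndegm.
Qed.

Lemma phiT_linear l (q : R) : q \is (a l).-homog ->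
  phiT k n a (\sum_(v : J n (a l)) q@_(jmnm v) *: Tvar k v) = q *: 'X_l.
Proof.
move=> homq; rewrite -[in RHS](sum_jmnm homq) scaler_suml raddf_sum; apply: eq_bigr => v _.
rewrite /= [LHS]mmapZ [X in _ * X](phiT_Tvar k (Tagged (fun l => J n (a l)) v)) /=.
by rewrite mul_mpolyC scalerA mul_mpolyC.
Qed.

End Linear.

Variables (e : 'I_r -> nat) (d : nat).
Hypothesis hom : forall l, f l \is (e l).-homog.
Hypothesis n0 : (0 < n)%N.
Local Notation a := (adeg e d).

(** The degree condition puts [m * f i] in degree [a j] and [m * f j] in degree [a i], so both are
    recovered from their coefficients on the monomials [jmnm v]. *)
Lemma phi_hform i j m : (mdeg m + (e i + e j) = d)%N ->
  phi k n a (hform f e d i j m)%:MP = ('X_[m] : R) *: koszul_rel f i j.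
Proof.
move=> degm; have homX l l' : (mdeg m + (e l + e l') = d)%N -> 'X_[m] * f l \is (a l').-homog.
  move=> degm'; have -> : a l' = (mdeg m + e l)%N by rewrite /adeg; lia.
  by apply: dhomogM => //; rewrite dhomogX.
rewrite phiC /hform rmorphD rmorphN /=.
rewrite (phiT_linear n0 (homX i j degm)) (phiT_linear n0 (homX j i _)); last first.
  by rewrite [(e j + _)%N]addnC.
by rewrite /koszul_rel scalerBr !scalerA addrC.
Qed.

Lemma Psi_hform i j m : (mdeg m + (e i + e j) = d)%N ->
  Psi f (phi k n a (hform f e d i j m)%:MP) = 0.
Proof.
move=> /phi_hform->; rewrite /koszul_rel scalerBr rmorphB !scalerA !PsiX !mdeg1.
apply/eqP; rewrite subr_eq0; apply/eqP; congr (_ *: _).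
have prodU l : \prod_l' f l' ^+ U_(l)%MM l' = f l.
  rewrite (bigD1 l) //= mnm1E eqxx big1 ?mulr1 // => l' neq.
  by rewrite mnm1E eq_sym (negPf neq).
by rewrite !prodU mulrAC.
Qed.

Hypothesis le_ed : forall i j : 'I_r, (i < j)%N -> (e i + e j <= d)%N.

Lemma Psi_kernel_ReesM (reg : regular_on f) (p : Rt) : ReesM a p -> Psi f p = 0 ->
  ideal_in (@ReesM k n r a) (fun p => exists2 h, hforms f h & p = phi k n a h%:MP) p.
Proof.
move=> Mp /(Psi_kernel reg) kosp; set G := fun _ => _.
(* It is enough to write [p] in this way up to an error [lo] of negative degree: [lo = p - hi] lies
   in the Rees algebra, which has only nonnegative degrees, so it vanishes. *)
suff [hi [lo [defp Ghi lo_lt]]] : exists hi lo : Rt,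
    [/\ p = hi + lo, ideal_in (@ReesM k n r a) G hi
      & bisupp (fun b => predC (wge (n := n) a 0 b)) lo].
  have Mhi : bisupp (wge a 0) hi.
    move: hi {defp} Ghi; apply: ideal_in_ind => [|x y|c _ Mc [h _ ->]].
    - exact: bisupp0.
    - exact: bisuppD.
    by apply/ReesMP => //; apply: (subalg_mul Mc); apply: phi_ReesM.
  suff lo0 : lo = 0 by rewrite defp lo0 addr0.
  apply: (bisupp_disjoint (P := wge a 0)) lo_lt.
  have -> : lo = p - hi by rewrite defp addrC addKr.
  by apply: bisuppB => //; apply/ReesMP.
move: p kosp {Mp}; apply: ideal_in_ind => [|x y|c _ _ [i [j [ltij _ ->]]]].
- by exists 0, 0; split; rewrite ?addr0 //; [exact: ideal_in0|exact: bisupp0].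
- move=> [hi [lo [-> ? ?]]] [hi' [lo' [-> ? ?]]].
  by exists (hi + hi'), (lo + lo'); split; [rewrite addrACA|exact: ideal_inD|exact: bisuppD].
have le_d := le_ed ltij.
(* The Koszul relation is homogeneous of degree [e i + e j - d], so the coefficient is cut at degree
   [d - (e i + e j)]. *)
have [hi [lo [hhi hlo ->]]] := bisupp_split (wge (n := n) a (d - (e i + e j))) c.
exists (hi * koszul_rel f i j), (lo * koszul_rel f i j); split; first by rewrite mulrDl.
  move: hi hhi; apply: bisupp_ind => [|x y|c' m b].
  - by rewrite mul0r; apply: ideal_in0.
  - by rewrite mulrDl; apply: ideal_inD.
  rewrite inE => le_m.
  (* The divisor [m1] has exactly the degree needed to form [hform], and the cofactor with [m2]
     still has nonnegative degree. *)
  have [|m1 [m2 [defm deg1]]] := @mnm_split_deg n (d - (e i + e j)) m; first lia.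
  have degd : (mdeg m1 + (e i + e j) = d)%N by rewrite deg1 subnK.
  have -> : ((c' *: 'X_[m]) *: 'X_[b]) * koszul_rel f i j
    = ((c' *: 'X_[m2]) *: 'X_[b]) * (('X_[m1] : R) *: koszul_rel f i j).
    rewrite defm mpolyXD -!scalerAl -!scalerAr !scalerA; congr (_ *: _).
    by rewrite -!mul_mpolyC; ring.
  rewrite -(phi_hform degd); apply: ideal_in_gen; last first.
    by exists (hform f e d i j m1) => //; exists i, j, m1.
  apply/ReesMP => //; apply: bisuppX; apply: suppX; rewrite inE addn0.
  by move: le_m; rewrite defm mdegD deg1; lia.
(* This is the equation of degree [e i + e j - d], satisfied by both terms of the Koszul
   relation. *)
pose Q b := [pred m : 'X_{1..n} | (weight a b + (e i + e j) == mdeg m + d)%N].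
apply: (bisuppM (Q := Q) hlo).
  apply: bisuppD; first apply: bisuppX.
    move=> m /(homog_supp hom); rewrite !inE weight1 => /eqP->.
    by rewrite /adeg; apply/eqP; lia.
  rewrite -scaleNr; apply: bisuppX; apply: suppN.
  move=> m /(homog_supp hom); rewrite !inE weight1 => /eqP->.
  by rewrite /adeg; apply/eqP; lia.
by move=> b m b' m'; rewrite !inE /wge /= weightD mdegD; lia.
Qed.

End PsiKernel.

(** * The kernel of phi *)

Section Minors.
Variables (A : comNzRingType) (m p : nat) (C : 'M[A]_(m, p)).

Lemma det2 (M : 'M[A]_2) :
  \det M = M ord0 ord0 * M ord_max ord_max - M ord_max ord0 * M ord0 ord_max.
Proof.
have lift00 : lift ord0 ord0 = ord_max :> 'I_2 by apply/val_inj.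
have lift10 : lift ord_max ord0 = ord0 :> 'I_2 by apply/val_inj.
rewrite (expand_det_col _ ord0) !big_ord_recl big_ord0 addr0 /cofactor !det_mx11 !mxE.
by rewrite lift00 lift10 /= expr0 expr1 mul1r mulN1r mulrN.
Qed.

Lemma minor2P x : minor2 C x ->
  exists s t c c', x = C s c * C t c' - C t c * C s c'.
Proof.
by case=> s [c [_ _ ->]]; rewrite det2 !mxE; eexists _, _, _, _; reflexivity.
Qed.

(** The generators use strictly increasing rows and columns; other choices change the sign or give
    0. *)
Lemma I2_minor s t c c' : I2 C (C s c * C t c' - C t c * C s c').
Proof.
have pos (s' t' : 'I_m) (c1 c2 : 'I_p) : (s' < t')%N -> (c1 < c2)%N ->
    I2 C (C s' c1 * C t' c2 - C t' c1 * C s' c2).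
  move=> lt_s lt_c; apply: ideal_gen.
  exists (fun i => if i == ord0 then s' else t'), (fun i => if i == ord0 then c1 else c2).
  by split=> [[[|[|//]] ?] [[|[|//]] ?]|[[|[|//]] ?] [[|[|//]] ?]|] //; rewrite det2 !mxE.
have I20 x : x = 0 -> I2 C x by move->; apply: ideal_in0.
have I2N x y : I2 C y -> x = - y -> I2 C x by move=> Iy ->; rewrite -mulN1r; apply: idealM.
have pos' (c1 c2 : 'I_p) : (c1 < c2)%N -> I2 C (C s c1 * C t c2 - C t c1 * C s c2).
  case: (ltngtP s t) => [ltst|ltts|/val_inj->] ltc.
  - exact: pos.
  - by apply: (I2N _ _ (pos _ _ _ _ ltts ltc)); rewrite opprB.
  - by apply: I20; rewrite subrr.
case: (ltngtP c c') => [|ltc|/val_inj->]; first exact: pos'.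
  by apply: (I2N _ _ (pos' _ _ ltc)); rewrite opprB ![C _ c' * _]mulrC.
by apply: I20; rewrite mulrC subrr.
Qed.

End Minors.

(** Within a group of equal key the coefficients sum to zero, so the group is a combination of
    differences with its first monomial. The induction removes the group of the head of the list. *)
Lemma ideal_grouped_sum (K A : comNzRingType) (G : A -> Prop) (iota : {rmorphism K -> A})
    (U : Type) (W : eqType) (g : U -> W) (mon : U -> A) (s : seq (K * U)) :
  (forall u v, g u = g v -> ideal G (mon u - mon v)) ->
  (forall w, \sum_(t <- s | g t.2 == w) t.1 = 0) ->
  ideal G (\sum_(t <- s) iota t.1 * mon t.2).
Proof.
move=> mon_g; move defz: (size s) => z; elim/ltn_ind: z s defz => z IHz [|t0 s'] defz.
  by rewrite big_nil => _; apply: ideal_in0.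
set s := t0 :: s' => sum0; rewrite (bigID (fun t => g t.2 == g t0.2)) /=.
apply: ideal_inD.
  have -> : \sum_(t <- s | g t.2 == g t0.2) iota t.1 * mon t.2 =
    \sum_(t <- s | g t.2 == g t0.2) iota t.1 * (mon t.2 - mon t0.2)
    + iota (\sum_(t <- s | g t.2 == g t0.2) t.1) * mon t0.2.
    rewrite raddf_sum mulr_suml -big_split /=; apply: eq_bigr => t _.
    by rewrite mulrBr subrK.
  rewrite sum0 rmorph0 mul0r addr0; apply: ideal_in_sum => t /eqP eq_g.
  exact/idealM/mon_g.
rewrite -big_filter; apply: (IHz _ _ _ (erefl _)).
  rewrite -defz /s /= eqxx /= ltnS size_filter; exact: count_size.
move=> w; rewrite big_filter_cond; have [->|neq_w] := eqVneq w (g t0.2).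
  by rewrite big_pred0 // => t; rewrite andNb.
rewrite -[RHS](sum0 w); apply: eq_bigl => t.
by case: eqP => // ->; rewrite eq_sym; case: eqP => // ew; rewrite ew eqxx in neq_w.
Qed.

Section PhiKernel.
Variables (k : fieldType) (n r : nat) (a : 'I_r -> nat).
Hypothesis n0 : (0 < n)%N.
Local Notation R := {mpoly k[n]}.
Local Notation Rt := {mpoly {mpoly k[n]}[r]}.
Local Notation S := {mpoly {mpoly k[#|{: Tidx n a}|]}[n]}.
Local Notation T w := ((Tvar k (tagged w))%:MP : S).
Local Notation Smon := (@Smon k n r a).
Implicit Types (w v : Tidx n a) (ws : seq (Tidx n a)) (m : 'X_{1..n}).

Definition shift (c : Cidx n a) (s : 'I_n) : Tidx n a :=
  Tagged (fun l => J n (a l)) (jshift (tagged (val c)) s).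

Lemma Cmx0 s : Cmx k n a s (lshift _ ord0) = 'X_s.
Proof. by rewrite /Cmx row_mxEl mxE. Qed.

Lemma CmxS s c : Cmx k n a s (rshift _ (enum_rank c)) = T (shift c s).
Proof. by rewrite /Cmx row_mxEr !mxE enum_rankK. Qed.

Definition minor_eq (p q : S) := I2 (Cmx k n a) (p - q).

Lemma minor_eq_trans q p p' : minor_eq p q -> minor_eq q p' -> minor_eq p p'.
Proof. by move=> h h'; rewrite /minor_eq -(subrKA q); apply: ideal_inD. Qed.

Lemma minor_eqM c p q : minor_eq p q -> minor_eq (c * p) (c * q).
Proof. by rewrite /minor_eq -mulrBr; apply: idealM. Qed.

Lemma minor_eq_xT c s t : minor_eq ('X_t * T (shift c s)) ('X_s * T (shift c t)).
Proof. by rewrite -!CmxS -!Cmx0; apply: I2_minor. Qed.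

Lemma minor_eq_TT c c' s t :
  minor_eq (T (shift c s) * T (shift c' t)) (T (shift c t) * T (shift c' s)).
Proof. by rewrite -!CmxS; apply: I2_minor. Qed.

(** If [x_s] divides the monomial of [w], then [w] sits in row [s] of some column; moving to row [t]
    of that column replaces one [x_s] by [x_t]. *)
Lemma column w s : jmnm (tagged w) s != 0%N ->
  exists c : Cidx n a, [/\ shift c s = w, forall t, tag (shift c t) = tag w
    & forall t, (U_(s) + jmnm (tagged (shift c t)) = jmnm (tagged w) + U_(t))%MM].
Proof.
case: w => l j /= js; have defj := mnm_subK js.
have degm : (mdeg (jmnm j - U_(s))).+1 = a l.
  by rewrite -[RHS](mdeg_jmnm j n0) [in RHS]defj mdegD mdeg1.
have [j' [j'1 shj']] := jshift_column degm n0.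
pose c : Cidx n a := Sub (Tagged (fun l => J n (a l)) j') j'1.
exists c; split=> // [|t]; last by rewrite /= shj' addmA -defj.
rewrite /shift /=; congr existT; apply: jmnm_inj.
by rewrite shj' addmC -defj.
Qed.

Lemma mnm_gt m1 m2 : mdeg m1 = mdeg m2 -> m1 != m2 -> exists s, (m2 s < m1 s)%N.
Proof.
move=> eqdeg neq; apply/existsP; apply: contraNT neq => /existsPn le12.
have le12' : (m1 <= m2)%MM by apply/mnm_lepP => i; rewrite leqNgt le12.
have := submK le12' => def2; have /eqP := congr1 (@mdeg n) def2.
rewrite mdegD eqdeg -[X in _ == X]add0n eqn_add2r mdeg_eq0 => /eqP d0.
by rewrite d0 add0m in def2; rewrite def2.
Qed.

Lemma jtotal_cons w ws : jtotal (w :: ws) = (jmnm (tagged w) + jtotal ws)%MM.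
Proof. exact: big_cons. Qed.

Lemma jtotal_cat ws ws' : jtotal (ws ++ ws') = (jtotal ws + jtotal ws')%MM.
Proof. exact: big_cat. Qed.

Lemma Smon_cons m w ws : Smon m (w :: ws) = T w * Smon m ws.
Proof. by rewrite /Smon /Tmon big_cons mpolyCM mulrA. Qed.

Lemma Smon_cat_cons m w ws ws' : Smon m (ws ++ w :: ws') = T w * Smon m (ws ++ ws').
Proof. by rewrite /Smon /Tmon !big_cat big_cons /= mulrCA mpolyCM mulrA. Qed.

Lemma Smon_X m i ws : Smon (U_(i) + m) ws = 'X_i * Smon m ws.
Proof. by rewrite /Smon mpolyXD mulrCA. Qed.

Lemma jtotal_neq0 ws t : jtotal ws t != 0%N ->
  exists ws1 v ws2, ws = ws1 ++ v :: ws2 /\ jmnm (tagged v) t != 0%N.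
Proof.
elim: ws => [|w ws IHws]; first by rewrite /jtotal big_nil mnm0E.
rewrite jtotal_cons mnmDE; have [w0|wt _] := eqVneq (jmnm (tagged w) t) 0%N.
  by rewrite w0 => /IHws[ws1 [v [ws2 [-> vt]]]]; exists (w :: ws1), v, ws2.
by exists [::], w, ws.
Qed.

(* The first factor is moved towards [w'] by exchanging one of its variables
   [x_s] with a missing [x_t] taken from another factor. *)
Lemma connect_head m w ws w' : tag w = tag w' ->
  (forall i, jmnm (tagged w') i <= (m + jtotal (w :: ws))%MM i)%N ->
  exists m' ws', [/\ map tag ws' = map tag ws,
    (m + jtotal (w :: ws) = m' + jtotal (w' :: ws'))%MM
    & minor_eq (Smon m (w :: ws)) (Smon m' (w' :: ws'))].
Proof.
(* The induction measure counts, with multiplicity, the variables that [w1] has in excess of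
   [w']. *)
pose dist w1 := (\sum_i (jmnm (tagged w1) i - jmnm (tagged w') i))%N.
move defD: (dist w) => D; elim/ltn_ind: D m w ws defD => D IHD m w ws defD tagw le_w'.
have [eqw|neqw] := eqVneq (jmnm (tagged w)) (jmnm (tagged w')).
  have -> : w = w'.
    case: (w) (w') tagw eqw => l j [l' j'] /= eql; case: _ / eql j' => j' /jmnm_inj->.
    by [].
  by exists m, ws; split=> //; rewrite /minor_eq subrr; apply: ideal_in0.
have eqdeg : mdeg (jmnm (tagged w)) = mdeg (jmnm (tagged w')).
  by rewrite !mdeg_jmnm // tagw.
have [s lt_s] := mnm_gt eqdeg neqw.
have [t lt_t] := mnm_gt (esym eqdeg) (contra_neq esym neqw).
have [|c [defw tagc jc]] := @column w s; first by rewrite -lt0n (leq_ltn_trans _ lt_s).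
have jcE i : ((s == i) + jmnm (tagged (shift c t)) i = jmnm (tagged w) i + (t == i))%N.
  by have /mnmP/(_ i) := jc t; rewrite !mnmDE !mnm1E.
(* One excess [x_s] disappears, and the added [x_t] was missing, so it creates no new excess. *)
have ltD : (dist (shift c t) < D)%N.
  rewrite -defD /dist (bigD1 s) // [X in (_ < X)%N](bigD1 s) // -addSn leq_add //.
    have := jcE s; rewrite eqxx; case: eqP => [ts|_]; last lia.
    by move: lt_s lt_t; rewrite ts; lia.
  apply: leq_sum => i /andP[_ neq_is]; have := jcE i; rewrite eq_sym (negPf neq_is).
  by case: eqP => [<-|_]; move: lt_t; lia.
have step m1 ws1 : map tag ws1 = map tag ws ->
    (m + jtotal (w :: ws) = m1 + jtotal (shift c t :: ws1))%MM ->
    minor_eq (Smon m (w :: ws)) (Smon m1 (shift c t :: ws1)) ->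
    exists m' ws', [/\ map tag ws' = map tag ws,
      (m + jtotal (w :: ws) = m' + jtotal (w' :: ws'))%MM
      & minor_eq (Smon m (w :: ws)) (Smon m' (w' :: ws'))].
  move=> tag1 tot1 eq1; have [||m' [ws' [tag' tot' eq']]] := IHD _ ltD m1 _ ws1 (erefl _).
  - by rewrite tagc.
  - by rewrite -tot1.
  by exists m', ws'; split; [rewrite tag'|rewrite tot1|apply: minor_eq_trans eq1 eq'].
(* The missing [x_t] is taken from the free part [m] if it occurs there, by a minor with the first
   column of [C]; otherwise from another factor [v], by a minor of [B]. *)
have [mt|mt] := eqVneq (m t) 0%N; last first.
  apply: (step (U_(s) + (m - U_(t)))%MM ws) => //.
    apply/mnmP => i; have /mnmP/(_ i) := mnm_subK mt; have := jcE i.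
    by rewrite !jtotal_cons !mnmDE !mnm1E; lia.
  rewrite [X in Smon X](mnm_subK mt) !Smon_cons !Smon_X.
  have mulE (x y z : S) : x * (y * z) = z * (y * x) by rewrite mulrA mulrC [x * y]mulrC.
  rewrite [X in minor_eq X]mulE [X in minor_eq _ X]mulE; apply: minor_eqM.
  by have := minor_eq_xT c s t; rewrite defw.
have [|ws1 [v [ws2 [defws vt]]]] := @jtotal_neq0 ws t.
  have := le_w' t; rewrite jtotal_cons !mnmDE mt; move: lt_t; lia.
have [c' [defv tagc' jc']] := column vt.
apply: (step m (ws1 ++ shift c' s :: ws2)).
- by rewrite defws !map_cat !map_cons tagc'.
- apply/mnmP => i; have := jcE i; have /mnmP/(_ i) := jc' s.
  by rewrite defws !jtotal_cons !jtotal_cat !jtotal_cons !mnmDE !mnm1E; lia.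
have mulE (x y z : S) : x * (y * z) = z * (x * y) by rewrite mulrA mulrC.
rewrite defws !Smon_cons !Smon_cat_cons [X in minor_eq X]mulE [X in minor_eq _ X]mulE.
by apply: minor_eqM; have := minor_eq_TT c c' s t; rewrite defw defv.
Qed.

Lemma perm_ttotal ws ws' : ttotal ws = ttotal ws' -> perm_eq (map tag ws) (map tag ws').
Proof.
move=> eqt; have countE ws1 l : ttotal ws1 l = count_mem l (map tag ws1).
  rewrite /ttotal; elim: ws1 => [|w ws1 IHws]; first by rewrite big_nil mnm0E.
  by rewrite big_cons mnmDE mnm1E IHws.
by apply/allP => l _ /=; rewrite -!countE eqt.
Qed.

(** Induction on the target word: a factor with the tag of its head is brought to the front, turned
    into that head by [connect_head], and cancelled. *)
Lemma Smon_connected m ws m' ws' : perm_eq (map tag ws) (map tag ws') ->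
  (m + jtotal ws = m' + jtotal ws')%MM -> minor_eq (Smon m ws) (Smon m' ws').
Proof.
elim: ws' m ws m' => [|w' ws' IHws] m ws m'.
  move/perm_nilP; case: ws => // _; rewrite /jtotal big_nil !addm0 => ->.
  by rewrite /minor_eq subrr; apply: ideal_in0.
move=> perm_ws tot.
have [ws1 [w [ws2 [defws tagw]]]] : exists ws1 w ws2, ws = ws1 ++ w :: ws2 /\ tag w = tag w'.
  have /mapP[w w_ws tagw] : tag w' \in map tag ws by rewrite (perm_mem perm_ws) mem_head.
  by case/splitPr: w_ws => ws1 ws2; exists ws1, w, ws2.
have perm12 : perm_eq (map tag (ws1 ++ ws2)) (map tag ws').
  rewrite -(perm_cons (tag w')) -[X in perm_eq _ X]/(map tag (w' :: ws')).
  rewrite -(permPr perm_ws) defws !map_cat /= tagw.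
  exact: permEl (perm_catCA [:: tag w'] (map tag ws1) (map tag ws2)).
have tot12 : (m + jtotal (w :: ws1 ++ ws2) = m' + jtotal (w' :: ws'))%MM.
  rewrite -tot defws !jtotal_cons !jtotal_cat jtotal_cons; congr (_ + _)%MM.
  by rewrite addmA [(jmnm _ + _)%MM]addmC -addmA.
have [|m1 [ws3 [tag3 tot3 eq3]]] := @connect_head m w (ws1 ++ ws2) w' tagw.
  by move=> i; rewrite tot12 jtotal_cons !mnmDE; lia.
have -> : Smon m ws = Smon m (w :: ws1 ++ ws2) by rewrite defws Smon_cat_cons Smon_cons.
apply: (minor_eq_trans eq3); rewrite !Smon_cons; apply/minor_eqM/IHws; first by rewrite tag3.
have := tot3; rewrite tot12 !jtotal_cons ![(_ + (jmnm _ + _))%MM]addmA.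
by rewrite ![(_ + jmnm _)%MM]addmC -!addmA => /addmI.
Qed.

Lemma Smon_decomp (s : S) : exists c : seq (k * ('X_{1..n} * seq (Tidx n a))),
  s = \sum_(t <- c) t.1%:MP%:MP * Smon t.2.1 t.2.2.
Proof.
move: s; apply: Smon_ind => [|p q [c ->] [c' ->]|c m ws].
- by exists [::]; rewrite big_nil.
- by exists (c ++ c'); rewrite big_cat.
by exists [:: (c, (m, ws))]; rewrite big_seq1.
Qed.

Lemma phi_kernel (s : S) : phi k n a s = 0 -> I2 (Cmx k n a) s.
Proof.
have [c ->] := Smon_decomp s => phi0.
(* The key of a monomial is the pair of exponents of its image, so the vanishing of [phi] says that
   the coefficients with a given key sum to zero. *)
apply: (@ideal_grouped_sum k S _ (@mpolyC n _ \o @mpolyC _ k) _ _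
  (fun u => ((u.1 + jtotal u.2)%MM, ttotal u.2)) (fun u => Smon u.1 u.2)).
  move=> u v equv; apply: Smon_connected; last exact: (congr1 fst equv).
  exact/perm_ttotal/(congr1 snd equv).
move=> [m b]; have := congr1 (fun p : Rt => p@_b@_m) phi0.
rewrite (raddf_sum (phi k n a)) (raddf_sum (mcoeff b)) (raddf_sum (mcoeff m)) !mcoeff0 => sum0.
rewrite big_mkcond -[RHS]sum0; apply: eq_bigr => t _.
have phit : phi k n a (t.1%:MP%:MP * Smon t.2.1 t.2.2)
    = t.1%:MP *: (('X_[t.2.1 + jtotal t.2.2] : R) *: 'X_[ttotal t.2.2]).
  by rewrite rmorphM phi_scalar phi_Smon mul_mpolyC.
rewrite [RHS](congr1 (fun q : Rt => q@_b@_m) phit) !mcoeffZ mcoeffCM mcoeffX.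
rewrite mulr_natr mcoeffMn mcoeffX mulrnAr -pair_eqE /=.
by do 2?case: eqP => _; rewrite ?mulr0n ?mulr1 ?mulr0 ?mulr1n.
Qed.

(** Under [phi] every column of [C] becomes a multiple of the column of the [x_s], so the image has
    rank at most one and its minors vanish. *)
Lemma I2_phi (s : S) : I2 (Cmx k n a) s -> phi k n a s = 0.
Proof.
have [g defC] : exists g : 'I_(1 + #|{: Cidx n a}|) -> Rt,
    forall c s, phi k n a (Cmx k n a s c) = ('X_s)%:MP * g c.
  pose i0 := Ordinal n0.
  apply: (@fin_all_exists _ _ (fun c g => forall s, phi k n a (Cmx k n a s c) = ('X_s)%:MP * g)).
  move=> c; rewrite -(splitK c); case: (split c) => {}c /=.
    by exists 1 => s'; rewrite (ord1 c) Cmx0 phiX mulr1.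
  rewrite -(enum_valK c); set v := enum_val c; set j := tagged (val v).
  (* The factor is the monomial of the column divided by the first variable; the division is exact
     because [1 <= j_1]. *)
  exists (('X_[jmnm j - U_(i0)] : R) *: 'X_(tag (val v))) => t.
  rewrite CmxS phiC phiT_Tvar /= mul_mpolyC scalerA -mpolyXD; congr ('X_[_] *: _).
  have j0 : jmnm j i0 != 0%N by have := svalP v; rewrite -/j (jentS j i0) jent0 lt0n.
  apply: (@addmI _ U_(i0)%MM); rewrite jmnm_jshift //; last exact: (svalP v).
  by rewrite {1}(mnm_subK j0) -addmA [(_ - _ + _)%MM]addmC.
move: s; apply: ideal_in_ind => [|x y|c _ _ /minor2P[s [t [c1 [c2 ->]]]]].
- exact: rmorph0.
- by rewrite rmorphD => -> ->; rewrite addr0.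
by rewrite rmorphM rmorphB !(rmorphM (phi k n a)) !defC; ring.
Qed.

End PhiKernel.

(** * The presentation *)

Section Presentation.
Variables (k : fieldType) (n r : nat) (f : 'I_r -> {mpoly k[n]}) (e : 'I_r -> nat) (d : nat).
Hypothesis n0 : (0 < n)%N.
Hypothesis hom : forall l, f l \is (e l).-homog.
Hypothesis reg : regular_on f.
Hypothesis le_e : forall l, (e l <= d)%N.
Hypothesis le_ee : forall i j : 'I_r, (i < j)%N -> (e i + e j <= d)%N.
Local Notation R := {mpoly k[n]}.
Local Notation Rt := {mpoly {mpoly k[n]}[r]}.
Local Notation a := (adeg e d).
Local Notation S := {mpoly {mpoly k[#|{: Tidx n a}|]}[n]}.

Lemma PsiU (u : R) l : Psi f (u *: 'X_l) = (u * f l) *: 'X.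
Proof. by rewrite [LHS]mmapZ mmapX mmap1U mul_polyC scalerA. Qed.

Lemma Psi_scalar (c : R) : Psi f c%:A = c%:A.
Proof. by rewrite alg_mpolyC [LHS]mmapC alg_polyC. Qed.

(** By [ItruncP] an element [g] of the truncation is a combination of the [f l] whose coefficients
    [u l] give the preimage of [g t]. Conversely, a generator with [t_l] is sent to degree
    [a l + e l = d]. *)
Lemma Psi_image b : ReesI f d b <-> exists2 p, ReesM a p & Psi f p = b.
Proof.
split=> [|[p Mp <-]].
  elim=> [c|_ [g /(ItruncP hom le_e)[u hu ->] ->]
    |x y _ [p Mp <-] _ [q Mq <-]|x y _ [p Mp <-] _ [q Mq <-]].
  - by exists c%:A; [exact: subalg_scalar|exact: Psi_scalar].
  - exists (\sum_l u l *: 'X_l).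
      apply/(ReesMP a n0)/bisupp_sum => l _; apply: bisuppX => m /(hu l).
      by rewrite !inE weight1 addn0.
    rewrite (raddf_sum (Psi f)) scaler_suml; apply: eq_bigr => l _; exact: PsiU.
  - by exists (p + q); [exact: (subalg_add Mp Mq)|rewrite rmorphD].
  - by exists (p * q); [exact: (subalg_mul Mp Mq)|rewrite rmorphM].
elim: Mp => [c|_ [l [j ->]]|x y _ hx _ hy|x y _ hx _ hy].
- by rewrite Psi_scalar; apply: subalg_scalar.
- rewrite PsiU; apply: subalg_gen; eexists; last reflexivity.
  split; first by apply: ideal_in_gen => //; exists l.
  move=> m; rewrite mulrC (perm_mem (msuppMX _ _)) => /mapP[m' /(dhomog_mf (hom l)) degm' ->].
  by rewrite mdegD degm' mdeg_jmnm // /adeg subnK.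
- by rewrite rmorphD; apply: (subalg_add hx hy).
- by rewrite rmorphM; apply: (subalg_mul hx hy).
Qed.

Let relM (p : Rt) := exists2 h, hforms f h & p = phi k n a h%:MP.
Let relS (s : S) := I2 (Cmx k n a) s \/ exists2 h, hforms f h & s = h%:MP.

Lemma Psi_relM p : ideal_in (@ReesM k n r a) relM p -> Psi f p = 0.
Proof.
move: p; apply: ideal_in_ind => [|x y|c _ _ [_ [i [j [m [_ degm ->]]]] ->]].
- exact: rmorph0.
- by rewrite rmorphD => -> ->; rewrite addr0.
by rewrite rmorphM (Psi_hform hom n0 degm) mulr0.
Qed.

(** The coefficients lift because [phi] is onto the Rees algebra, and the generators are by
    definition images of the forms [h]. *)
Lemma relM_lift p : ideal_in (@ReesM k n r a) relM p ->
  exists2 s : S, ideal relS s & phi k n a s = p.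
Proof.
move: p; apply: ideal_in_ind => [|x y [s Is <-] [s' Is' <-]|c _ /phi_surj[s <-] [h hh ->]].
- by exists 0; [exact: ideal_in0|exact: rmorph0].
- by exists (s + s'); [exact: ideal_inD|exact: rmorphD].
by exists (s * h%:MP); [apply: ideal_in_gen => //; right; exists h|exact: rmorphM].
Qed.

Lemma chi_kernel (s : S) : chi f e d s = 0 <-> ideal relS s.
Proof.
have chiE x : chi f e d x = Psi f (phi k n a x) by [].
split=> [chi0|].
  have := Psi_kernel_ReesM hom n0 le_ee reg (phi_ReesM n0 s) chi0.
  move=> /relM_lift[s' Is' phis'].
  (* The lift [s'] has the same image as [s] under [phi], so their difference is in the kernel of
     [phi]. *)
  have Is : ideal relS (s - s').
    by apply: ideal_gen; left; apply: (phi_kernel n0); rewrite rmorphB phis' subrr.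
  by rewrite -[s](subrK s'); apply: (ideal_inD Is Is').
move: s; apply: ideal_in_ind => [|x y|c g _ [/(I2_phi n0) phi0|[_ [i [j [m [_ degm ->]]]] ->]]].
- exact: rmorph0.
- by rewrite rmorphD => -> ->; rewrite addr0.
- by rewrite rmorphM [X in _ * X]chiE phi0 rmorph0 mulr0.
by rewrite rmorphM [X in _ * X]chiE (Psi_hform hom n0 degm) mulr0.
Qed.

End Presentation.

Theorem theorem3p9 (k : fieldType) (n r : nat) (h2r : (2 <= r)%N)
    (hrn : (r <= n)%N) (f : 'I_r -> {mpoly k[n]}) (e : 'I_r -> nat) (d : nat)
    (hhomog : forall l : 'I_r, f l \is (e l).-homog)
    (hreg : regular_sequence f)
    (hdeg : forall i j : 'I_r, (i <= j)%N -> (e j <= e i)%N)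
    (hd : (e (Ordinal (ltnW h2r)) + e (Ordinal h2r) <= d)%N) :
  (forall g : {mpoly k[n]},
     Itrunc f d g <->
     exists2 u : 'I_r -> {mpoly k[n]},
       (forall l, ideal_exp (@max_ideal k n) (adeg e d l) (u l))
       & g = \sum_(l < r) u l * f l)
  /\ is_quotient_via (Psi f) (@ReesM k n r (adeg e d)) (ReesI f d)
       (ideal_in (@ReesM k n r (adeg e d))
          (fun p => exists2 h, hforms f h & p = phi k n (adeg e d) h%:MP))
  /\ is_quotient_via (chi f e d) (fun _ => True) (ReesI f d)
       (ideal (fun s => I2 (Cmx k n (adeg e d)) s
                        \/ exists2 h, hforms f h & s = h%:MP)).
Proof.
have n0 : (0 < n)%N by apply: leq_trans hrn; apply: ltnW.
have e0 l : (e l <= e (Ordinal (ltnW h2r)))%N by apply: hdeg.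
have le_e l : (e l <= d)%N by apply: leq_trans (e0 l) (leq_trans (leq_addr _ _) hd).
(* The index [j] is at least 1, so the decreasing degrees bound [e i + e j] by the sum of the first
   two. *)
have le_ee (i j : 'I_r) : (i < j)%N -> (e i + e j <= d)%N.
  move=> ltij; apply: leq_trans hd; apply: leq_add => //.
  by apply: hdeg; apply: leq_trans ltij.
have reg : regular_on f by case: hreg.
split; last split.
- move=> g; split=> [/(ItruncP hhomog le_e)[u hu ->]|[u hu ->]].
    by exists u => // l; apply/ideal_exp_maxP.
  by apply/(ItruncP hhomog le_e); exists u => // l; apply/ideal_exp_maxP.
- split; first exact: Psi_image.
  by move=> p Mp; split; [exact: Psi_kernel_ReesM|exact: Psi_relM].
split=> [b|s _]; last exact: chi_kernel.
split=> [/(Psi_image n0 hhomog le_e)[p /phi_surj[s <-] <-]|[s _ <-]]; first by exists s.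
by apply/(Psi_image n0 hhomog le_e); exists (phi k n (adeg e d) s); [exact: phi_ReesM|].
Qed.
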